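(* Every Turing degree above that of $\Omega$ contains a Martin-Löf random set of the form $X\oplus Y$ such that $X$ is low and $Y$ is Turing incomplete.
   Context: $\Omega$ is Chaitin's halting probability (as a set via its binary expansion). $X$ is low if $X'\equiv_T\emptyset'$; $Y$ is Turing incomplete if $\emptyset'\not\le_T Y$. *)

(* Defs.v *)
From HB Require Import structures.
From Stdlib Require Cantor.
From mathcomp Require Import all_boot all_order all_algebra.
From mathcomp Require Import all_classical all_reals all_analysis.

Set Implicit Arguments.
Unset Strict Implicit.
Unset Printing Implicit Defensive.

Import Order.TTheory GRing.Theory Num.Theory.

Local Open Scope classical_set_scope.
Local Open Scope ring_scope.
Local Open Scope ereal_scope.
Local Open Scope nat_scope.

Definition npair (m n : nat) : nat := Cantor.to_nat (m, n).

(* Programs for the partial recursive functions nat -> nat relative to an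
   oracle.  Functions of several arguments take a single [npair]-coded one. *)
Inductive prog : Type :=
| Zero
| Succ
| Fst
| Snd
| Oracle
| Pair of prog & prog
| Comp of prog & prog
| Prec of prog & prog
| Mu of prog.

(* [prog_eval A c n y]: program [c] with oracle [A] halts on input [n], with
   output [y]. *)
Inductive prog_eval (A : set nat) : prog -> nat -> nat -> Prop :=
| eval_zero n : prog_eval A Zero n 0
| eval_succ n : prog_eval A Succ n n.+1
| eval_fst m n : prog_eval A Fst (npair m n) m
| eval_snd m n : prog_eval A Snd (npair m n) n
| eval_oracle n : prog_eval A Oracle n `[< A n >]
| eval_pair f g n x y :
    prog_eval A f n x -> prog_eval A g n y -> prog_eval A (Pair f g) n (npair x y)
| eval_comp f g n x y :
    prog_eval A g n x -> prog_eval A f x y -> prog_eval A (Comp f g) n y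
| eval_prec0 f g a y :
    prog_eval A f a y -> prog_eval A (Prec f g) (npair a 0) y
| eval_precS f g a m x y :
    prog_eval A (Prec f g) (npair a m) x ->
    prog_eval A g (npair a (npair m x)) y ->
    prog_eval A (Prec f g) (npair a m.+1) y
| eval_mu f a m (w : nat -> nat) :
    (forall k, k < m -> prog_eval A f (npair a k) (w k).+1) ->
    prog_eval A f (npair a m) 0 ->
    prog_eval A (Mu f) a m.

Definition halts (A : set nat) (c : prog) (n : nat) : Prop :=
  exists y, prog_eval A c n y.

(* A bijective Goedel numbering of programs. *)
Fixpoint prog_num (c : prog) : nat :=
  match c with
  | Zero => 0
  | Succ => 1
  | Fst => 2
  | Snd => 3
  | Oracle => 4
  | Pair f g => 5 + 4 * npair (prog_num f) (prog_num g)
  | Comp f g => 6 + 4 * npair (prog_num f) (prog_num g)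
  | Prec f g => 7 + 4 * npair (prog_num f) (prog_num g)
  | Mu f => 8 + 4 * prog_num f
  end.

Definition turing_le (A B : set nat) : Prop :=
  exists c, forall n, prog_eval B c n `[< A n >].

Definition turing_equiv (A B : set nat) : Prop :=
  turing_le A B /\ turing_le B A.

Definition turing_degree (A : set nat) : set (set nat) :=
  [set B | turing_equiv B A].

Definition jump (A : set nat) : set nat :=
  [set e | exists2 c, prog_num c = e & halts A c e].

Definition low (X : set nat) : Prop := turing_equiv (jump X) (jump set0).

Definition turing_incomplete (Y : set nat) : Prop := ~ turing_le (jump set0) Y.

Definition tjoin (X Y : set nat) : set nat :=
  [set n | if odd n then Y n./2 else X n./2].

(* Bijective base-2 numeration, identifying binary strings with naturals. *)
Fixpoint str_num (s : seq bool) : nat :=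
  if s is b :: s' then (str_num s').*2 + b.+1 else 0.

(* The partial computable function on strings of a program; computability is
   relative to the empty oracle. *)
Definition machine (M : prog) (p s : seq bool) : Prop :=
  prog_eval set0 M (str_num p) (str_num s).

Definition machine_dom (M : prog) : set (seq bool) :=
  [set p | exists s, machine M p s].

Definition prefix_free (M : prog) : Prop :=
  forall p q, machine_dom M p -> machine_dom M q -> prefix p q -> p = q.

(* Every prefix-free machine is simulated with at most a constant increase in
   program length; this includes machines that are universal by adjunction,
   i.e. [U (rho ++ p) = M p] for some [rho] depending only on [M]. *)
Definition universal_prefix_free (U : prog) : Prop :=
  prefix_free U /\
  forall M, prefix_free M ->
    exists d : nat, forall p s, machine M p s ->
      exists2 q, machine U q s & size q <= size p + d.

Definition halting_probability (R : realType) (U : prog) : R :=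
  fine (\esum_(p in machine_dom U) (2 ^- size p)%:E)%E.

(* The [n]-th bit is the digit of weight [2 ^- n.+1]. *)
Definition binary_expansion (R : realType) (x : R) : set nat :=
  [set n | odd (Num.truncn (2 ^+ n.+1 * x)%R)].

Definition Omega (R : realType) (U : prog) : set nat :=
  binary_expansion (halting_probability R U).

(* Cantor space is [set nat]. *)
Definition cylinder (s : seq bool) : set (set nat) :=
  [set Z | forall i, i < size s -> nth false s i = `[< Z i >]].

Definition open_of (C : set (seq bool)) : set (set nat) :=
  \bigcup_(s in C) cylinder s.

(* The uniform (fair-coin) outer measure on Cantor space, given by covers by
   cylinders; it is only applied to open sets. *)
Definition uniform_measure (R : realType) (S : set (set nat)) : \bar R :=
  ereal_inf [set (\esum_(s in C) (2 ^- size s)%:E)%E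
            | C in [set C : set (seq bool) | S `<=` open_of C]].

(* The [n]-th member of the uniformly c.e. sequence of sets of strings
   enumerated by [c]. *)
Definition ce_section (c : prog) (n : nat) : set (seq bool) :=
  [set s | halts set0 c (npair n (str_num s))].

Definition ml_test (R : realType) (c : prog) : Prop :=
  forall n, (uniform_measure R (open_of (ce_section c n)) <= (2 ^- n)%:E)%E.

Definition ml_random (R : realType) (Z : set nat) : Prop :=
  forall c, ml_test R c -> ~ (\bigcap_n open_of (ce_section c n)) Z.

(* Main.v *)
(* The open sets killed by a clipped universal test have total measure at most 1/2, so the
   [Pi_1] class [Q] of the surviving sequences consists of random ones.  The class of the [X]
   whose section [{Y | X (+) Y \in Q}] has measure at least 1/2 is again [Pi_1] and nonempty,
   hence has a low member [X] by the low basis theorem.  Coding [A] into a [Y] in the section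
   by Kucera's method is computable in [X' (+) A], that is in [A], because [A] computes the
   halting problem.  Finally [X] is computable in the halting problem, so if [Y] computed the
   latter it would compute [X], and [X (+) Y] would not be random.

   A string of length [s] is represented by a number [v < 2 ^ s] whose binary digit [i] is
   letter [i] of the string; its initial segment of length [t] is [v %% 2 ^ t], and measures
   become cardinalities. *)
Require Import Defs.
From Stdlib Require Cantor.
From mathcomp Require Import all_boot all_order all_algebra.
From mathcomp Require Import all_classical all_reals all_analysis.
From mathcomp Require Import zify lra.

Set Implicit Arguments.
Unset Strict Implicit.
Unset Printing Implicit Defensive.

Local Open Scope classical_set_scope.
Local Open Scope nat_scope.

(** * Relative computability *)

(** Lowness of [X] serves twice. Whether a string keeps positive measure in the section above [X] is
    a question to the jump of [X], which [A] can answer; and [X] computable in the halting problem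
    turns completeness of [Y] into [X] computable from [Y], which a single explicit test rules out.
    The obstacle lies in decoding, where only [X] and [Y] are at hand and density cannot be decided.
    Loss of density, however, is a Sigma_1 event relative to [X]. A chosen extension that is extreme
    among the dense ones has only failing extensions on one side, and these are seen to fail at a
    finite resolution; a second dense extension on the other side excludes the opposite answer. Two
    dense extensions exist if the required density is halved at each coded bit and the blocks grow
    accordingly. That [Omega] computes the halting problem has to be derived from universality
    alone, which gives a constant [d] and says nothing about how [U] codes programs. Halting times
    are therefore put into the outputs of an auxiliary prefix-free machine, whose short programs [U]
    must match. *)

Definition nfst (n : nat) : nat := (Cantor.of_nat n).1.
Definition nsnd (n : nat) : nat := (Cantor.of_nat n).2.

Lemma nfst_npair m n : nfst (npair m n) = m.
Proof. by rewrite /nfst /npair Cantor.cancel_of_to. Qed.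

Lemma nsnd_npair m n : nsnd (npair m n) = n.
Proof. by rewrite /nsnd /npair Cantor.cancel_of_to. Qed.

Lemma npair_eta n : npair (nfst n) (nsnd n) = n.
Proof. by rewrite /npair /nfst /nsnd -surjective_pairing Cantor.cancel_to_of. Qed.

Lemma npair_inj m n m' n' : npair m n = npair m' n' -> m = m' /\ n = n'.
Proof.
move=> e; split; first by rewrite -(nfst_npair m n) e nfst_npair.
by rewrite -(nsnd_npair m n) e nsnd_npair.
Qed.

Lemma npair_ge_r m n : n <= npair m n.
Proof. have := Cantor.to_nat_non_decreasing m n; rewrite /npair; lia. Qed.

Lemma npair_ge_l m n : m <= npair m n.
Proof. have := Cantor.to_nat_non_decreasing m n; rewrite /npair; lia. Qed.

(** The indices [npair a m] of the rules are not patterns; stating the inversions through the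
    projections makes them apply to any argument. *)
Lemma prog_eval_inv A c n y : prog_eval A c n y ->
  match c with
  | Zero => y = 0
  | Succ => y = n.+1
  | Fst => y = nfst n
  | Snd => y = nsnd n
  | Oracle => y = `[< A n >]
  | Pair f g => exists x z,
      [/\ prog_eval A f n x, prog_eval A g n z & y = npair x z]
  | Comp f g => exists2 x, prog_eval A g n x & prog_eval A f x y
  | Prec f g => if nsnd n is m.+1 then
      exists2 x, prog_eval A (Prec f g) (npair (nfst n) m) x &
        prog_eval A g (npair (nfst n) (npair m x)) y
      else prog_eval A f (nfst n) y
  | Mu f => exists2 w : nat -> nat,
      (forall k, k < y -> prog_eval A f (npair n k) (w k).+1) &
      prog_eval A f (npair n y) 0
  end.
Proof.
case=> //= *; rewrite ?nfst_npair ?nsnd_npair //; first by eexists; eexists; split; eauto.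
- by eexists; eauto.
- by eexists; eauto.
- by eexists; eauto.
Qed.

Lemma prog_eval_det A c n y z : prog_eval A c n y -> prog_eval A c n z -> y = z.
Proof.
move=> H; elim: H z => {c n y}.
- by move=> n z /prog_eval_inv.
- by move=> n z /prog_eval_inv.
- by move=> m n z /prog_eval_inv; rewrite nfst_npair.
- by move=> m n z /prog_eval_inv; rewrite nsnd_npair.
- by move=> n z /prog_eval_inv.
- by move=> f g n x y _ IHf _ IHg z /prog_eval_inv [x' [y' [/IHf <- /IHg <- ->]]].
- by move=> f g n x y _ IHg _ IHf z /prog_eval_inv [x' /IHg <- /IHf].
- by move=> f g a y _ IH z /prog_eval_inv; rewrite nfst_npair nsnd_npair => /IH.
- move=> f g a m x y _ IH1 _ IH2 z /prog_eval_inv; rewrite nfst_npair nsnd_npair.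
  by move=> [x' /IH1 <- /IH2].
- move=> f a m w _ IH1 _ IH2 z /prog_eval_inv [w' H1 H2].
  case: (ltngtP m z) => // lt; first by have := IH2 _ (H1 _ lt).
  by have := IH1 _ lt _ H2.
Qed.

Lemma prog_num_inj : injective prog_num.
Proof.
elim=> [|||||f IHf g IHg|f IHf g IHg|f IHf g IHg|f IHf] [|||||f' g'|f' g'|f' g'|f'] //= e;
  try lia.
- have /npair_inj[/IHf -> /IHg ->] // :
    npair (prog_num f) (prog_num g) = npair (prog_num f') (prog_num g') by lia.
- have /npair_inj[/IHf -> /IHg ->] // :
    npair (prog_num f) (prog_num g) = npair (prog_num f') (prog_num g') by lia.
- have /npair_inj[/IHf -> /IHg ->] // :
    npair (prog_num f) (prog_num g) = npair (prog_num f') (prog_num g') by lia.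
- by rewrite (IHf f') //; lia.
Qed.

Lemma prog_num_surj n : exists c, prog_num c = n.
Proof.
elim/ltn_ind: n => n IH.
case: (ltnP n 5) => [|le5].
  by case: n {IH} => [|[|[|[|[|//]]]]] _; [exists Zero|exists Succ|exists Fst|exists Snd|exists Oracle].
have en := divn_eq (n - 5) 4; have lt4 := ltn_pmod (n - 5) (isT : 0 < 4).
set q := (n - 5) %/ 4 in en; set r := (n - 5) %% 4 in en lt4.
have eq_q := npair_eta q.
have [f ef] : exists f, prog_num f = nfst q.
  by apply: IH; have := npair_ge_l (nfst q) (nsnd q); lia.
have [g eg] : exists g, prog_num g = nsnd q.
  by apply: IH; have := npair_ge_r (nfst q) (nsnd q); lia.
have [h eh] : exists h, prog_num h = q by apply: IH; lia.
case: r en lt4 => [|[|[|[|//]]]] en _.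
- by exists (Pair f g); rewrite /= ef eg eq_q; lia.
- by exists (Comp f g); rewrite /= ef eg eq_q; lia.
- by exists (Prec f g); rewrite /= ef eg eq_q; lia.
- by exists (Mu h); rewrite /= eh; lia.
Qed.

Definition recin (A : set nat) (f : nat -> nat) : Prop :=
  exists c, forall n, prog_eval A c n (f n).

Definition recin2 (A : set nat) (F : nat -> nat -> nat) : Prop :=
  recin A (fun p => F (nfst p) (nsnd p)).

Section Closure.
Variable A : set nat.
Implicit Types f g h : nat -> nat.

Lemma recin_ext f g : f =1 g -> recin A f -> recin A g.
Proof. by move=> e [c H]; exists c => n; rewrite -e. Qed.

Lemma recin_nfst : recin A nfst.
Proof. by exists Fst => n; rewrite -{1}(npair_eta n); apply: eval_fst. Qed.

Lemma recin_nsnd : recin A nsnd.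
Proof. by exists Snd => n; rewrite -{1}(npair_eta n); apply: eval_snd. Qed.

Lemma recin_comp f g : recin A f -> recin A g -> recin A (fun n => f (g n)).
Proof. by move=> [c H] [d K]; exists (Comp c d) => n; apply: eval_comp; eauto. Qed.

Lemma recin_pair f g : recin A f -> recin A g -> recin A (fun n => npair (f n) (g n)).
Proof. by move=> [c H] [d K]; exists (Pair c d) => n; apply: eval_pair; eauto. Qed.

Lemma recin_id : recin A (fun n => n).
Proof.
apply: (@recin_ext (fun n => npair (nfst n) (nsnd n))) npair_eta _.
exact: recin_pair recin_nfst recin_nsnd.
Qed.

Lemma recin_succ f : recin A f -> recin A (fun n => (f n).+1).
Proof. by apply: (recin_comp (f := S)); exists Succ => n; apply: eval_succ. Qed.

Lemma recin_const k : recin A (fun=> k).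
Proof. by elim: k => [|k IH]; [exists Zero => n; apply: eval_zero|apply: recin_succ]. Qed.

Lemma recin_oracle f : recin A f -> recin A (fun n => nat_of_bool `[< A (f n) >]).
Proof.
by apply: (recin_comp (f := fun n => nat_of_bool `[< A n >])); exists Oracle => n; apply: eval_oracle.
Qed.

Lemma recin_app2 F f g : recin2 A F -> recin A f -> recin A g ->
  recin A (fun n => F (f n) (g n)).
Proof.
move=> HF Hf Hg; have := recin_comp HF (recin_pair Hf Hg).
by apply: recin_ext => n; rewrite nfst_npair nsnd_npair.
Qed.

Lemma recin_app3 (F : nat -> nat -> nat -> nat) f g h :
  recin A (fun p => F (nfst p) (nfst (nsnd p)) (nsnd (nsnd p))) ->
  recin A f -> recin A g -> recin A h -> recin A (fun n => F (f n) (g n) (h n)).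
Proof.
move=> HF Hf Hg Hh; have := recin_comp HF (recin_pair Hf (recin_pair Hg Hh)).
by apply: recin_ext => n; rewrite !(nfst_npair, nsnd_npair).
Qed.

Lemma recin_natrec b f (G : nat -> nat -> nat -> nat) :
  recin A b -> recin A f -> recin A (fun p => G (nfst p) (nfst (nsnd p)) (nsnd (nsnd p))) ->
  recin A (fun n => nat_rect (fun=> nat) (f n) (fun k r => G n k r) (b n)).
Proof.
move=> Hb [c Hc] [d Hd].
apply: (recin_app2 (F := fun n m => nat_rect (fun=> nat) (f n) (fun k r => G n k r) m) _ recin_id Hb).
exists (Prec c d) => n; rewrite -{1}(npair_eta n).
elim: (nsnd n) => [|m IH] /=; first exact: eval_prec0.
apply: eval_precS IH _.
pose r := nat_rect (fun=> nat) (f (nfst n)) (fun k r => G (nfst n) k r) m.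
by have := Hd (npair (nfst n) (npair m r)); rewrite !(nfst_npair, nsnd_npair).
Qed.

Lemma recin_iter b f (G : nat -> nat -> nat) :
  recin A b -> recin A f -> recin2 A G ->
  recin A (fun n => iter (b n) (G n) (f n)).
Proof.
move=> Hb Hf HG.
apply: (@recin_ext (fun n => nat_rect (fun=> nat) (f n) (fun k r => G n r) (b n))).
  by move=> n; elim: (b n) => //= m ->.
apply: recin_natrec => //.
exact: (recin_app2 HG recin_nfst (recin_comp recin_nsnd recin_nsnd)).
Qed.

Lemma recin_pred f : recin A f -> recin A (fun n => (f n).-1).
Proof.
move=> Hf.
apply: (@recin_ext (fun n => nat_rect (fun=> nat) 0 (fun k r => k) (f n))).
  by move=> n; case: (f n).
apply: (recin_natrec (G := fun n k r => k)) => //; first exact: recin_const.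
exact: recin_comp recin_nfst recin_nsnd.
Qed.

Lemma recin_add f g : recin A f -> recin A g -> recin A (fun n => f n + g n).
Proof.
move=> Hf Hg; apply: (@recin_ext (fun n => iter (g n) S (f n))).
  by move=> n; rewrite addnC; elim: (g n) => //= m ->.
by apply: (recin_iter (G := fun=> S)) => //; apply: recin_succ; apply: recin_nsnd.
Qed.

Lemma recin_sub f g : recin A f -> recin A g -> recin A (fun n => f n - g n).
Proof.
move=> Hf Hg; apply: (@recin_ext (fun n => iter (g n) predn (f n))).
  by move=> n; elim: (g n) => /= [|m ->]; lia.
by apply: (recin_iter (G := fun=> predn)) => //; apply: recin_pred; apply: recin_nsnd.
Qed.

Lemma recin_mul f g : recin A f -> recin A g -> recin A (fun n => f n * g n).
Proof.
move=> Hf Hg; apply: (@recin_ext (fun n => iter (g n) (addn (f n)) 0)).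
  by move=> n; elim: (g n) => /= [|m ->]; lia.
apply: (recin_iter (G := fun n => addn (f n))) => //; first exact: recin_const.
apply: recin_add; last exact: recin_nsnd.
by apply: recin_comp => //; apply: recin_nfst.
Qed.

Lemma recin_exp f g : recin A f -> recin A g -> recin A (fun n => f n ^ g n).
Proof.
move=> Hf Hg; apply: (@recin_ext (fun n => iter (g n) (muln (f n)) 1)).
  by move=> n; elim: (g n) => //= m ->; rewrite expnS.
apply: (recin_iter (G := fun n => muln (f n))) => //; first exact: recin_const.
apply: recin_mul; last exact: recin_nsnd.
by apply: recin_comp => //; apply: recin_nfst.
Qed.

Lemma recin_eq0 f : recin A f -> recin A (fun n => nat_of_bool (f n == 0)).
Proof.
move=> Hf; apply: (@recin_ext (fun n => 1 - f n)); first by move=> n; case: (f n).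
by apply: recin_sub => //; apply: recin_const.
Qed.

Lemma recin_leq f g : recin A f -> recin A g -> recin A (fun n => nat_of_bool (f n <= g n)).
Proof. by move=> Hf Hg; apply/recin_eq0/recin_sub. Qed.

Lemma recin_neg (P : nat -> bool) : recin A (fun n => nat_of_bool (P n)) ->
  recin A (fun n => nat_of_bool (~~ P n)).
Proof.
move=> H; apply: (@recin_ext (fun n => 1 - P n)); first by move=> n; case: (P n).
by apply: recin_sub => //; apply: recin_const.
Qed.

Lemma recin_and (P Q : nat -> bool) : recin A (fun n => nat_of_bool (P n)) ->
  recin A (fun n => nat_of_bool (Q n)) -> recin A (fun n => nat_of_bool (P n && Q n)).
Proof.
move=> H K; apply: (@recin_ext (fun n => P n * Q n)) (recin_mul H K).
by move=> n; case: (P n); case: (Q n).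
Qed.

Lemma recin_or (P Q : nat -> bool) : recin A (fun n => nat_of_bool (P n)) ->
  recin A (fun n => nat_of_bool (Q n)) -> recin A (fun n => nat_of_bool (P n || Q n)).
Proof.
move=> H K; apply: (@recin_ext (fun n => nat_of_bool (~~ (~~ P n && ~~ Q n)))).
  by move=> n; case: (P n); case: (Q n).
by apply: recin_neg; apply: recin_and; apply: recin_neg.
Qed.

Lemma recin_implb (P Q : nat -> bool) : recin A (fun n => nat_of_bool (P n)) ->
  recin A (fun n => nat_of_bool (Q n)) -> recin A (fun n => nat_of_bool (P n ==> Q n)).
Proof.
move=> H K; apply: (@recin_ext (fun n => nat_of_bool (~~ P n || Q n))).
  by move=> n; case: (P n); case: (Q n).
by apply: recin_or => //; apply: recin_neg.
Qed.

Lemma recin_eq f g : recin A f -> recin A g -> recin A (fun n => nat_of_bool (f n == g n)).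
Proof.
move=> Hf Hg; apply: (@recin_ext (fun n => nat_of_bool ((f n <= g n) && (g n <= f n)))).
  by move=> n; rewrite eqn_leq.
by apply: recin_and; apply: recin_leq.
Qed.

Lemma recin_if (P : nat -> bool) f g : recin A (fun n => nat_of_bool (P n)) ->
  recin A f -> recin A g -> recin A (fun n => if P n then f n else g n).
Proof.
move=> HP Hf Hg; apply: (@recin_ext (fun n => P n * f n + (~~ P n) * g n)).
  by move=> n; case: (P n); rewrite /= ?mul1n ?mul0n ?addn0.
by apply: recin_add; apply: recin_mul => //; apply: recin_neg.
Qed.

Lemma recin_ifb (P Q S : nat -> bool) : recin A (fun n => nat_of_bool (P n)) ->
  recin A (fun n => nat_of_bool (Q n)) -> recin A (fun n => nat_of_bool (S n)) ->
  recin A (fun n => nat_of_bool (if P n then Q n else S n)).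
Proof.
move=> HP Hf Hg; apply: (@recin_ext (fun n => if P n then nat_of_bool (Q n) else S n)).
  by move=> n; case: (P n).
exact: recin_if.
Qed.

End Closure.

(** * Bounded sums, bounded quantifiers and division *)

Definition ssum (N : nat) (F : nat -> nat) : nat := \sum_(i < N) F i.
Definition balln (N : nat) (P : nat -> bool) : bool := all P (iota 0 N).
Definition bexn (N : nat) (P : nat -> bool) : bool := has P (iota 0 N).

Lemma ballnP N (P : nat -> bool) : reflect (forall i, i < N -> P i) (balln N P).
Proof.
apply: (iffP allP) => H i; last by rewrite mem_iota add0n => /andP[_]; apply: H.
by move=> lt; apply: H; rewrite mem_iota.
Qed.

Lemma ballnS N P : balln N.+1 P = balln N P && P N.
Proof. by rewrite /balln -addn1 iotaD all_cat /= andbT. Qed.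

Lemma bexnP N (P : nat -> bool) : reflect (exists2 i, i < N & P i) (bexn N P).
Proof.
apply: (iffP hasP) => -[i H Pi]; exists i => //; last by rewrite mem_iota.
by move: H; rewrite mem_iota.
Qed.

Section ClosureBounded.
Variable A : set nat.
Implicit Types f g h b : nat -> nat.

Lemma recin_ssum b (F : nat -> nat -> nat) : recin A b -> recin2 A F ->
  recin A (fun n => ssum (b n) (F n)).
Proof.
move=> Hb HF.
apply: (@recin_ext _ (fun n => nat_rect (fun=> nat) 0 (fun k r => r + F n k) (b n))).
  move=> n; elim: (b n) => [|m IH] /=; first by rewrite /ssum big_ord0.
  by rewrite IH /ssum big_ord_recr.
apply: (recin_natrec (G := fun n k r => r + F n k)) => //; first exact: recin_const.
apply: recin_add; first exact: recin_comp (recin_nsnd A) (recin_nsnd A).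
exact: (recin_app2 HF (recin_nfst A) (recin_comp (recin_nfst A) (recin_nsnd A))).
Qed.

Lemma recin_balln b (P : nat -> nat -> bool) : recin A b ->
  recin2 A (fun n i => nat_of_bool (P n i)) -> recin A (fun n => nat_of_bool (balln (b n) (P n))).
Proof.
move=> Hb HP.
apply: (@recin_ext _ (fun n => nat_rect (fun=> nat) 1 (fun k r => r * P n k) (b n))).
  move=> n; elim: (b n) => [|m IH] //.
  by rewrite ballnS /= IH; case: balln; case: (P n m).
apply: (recin_natrec (G := fun n k r => r * P n k)) => //; first exact: recin_const.
apply: recin_mul; first exact: recin_comp (recin_nsnd A) (recin_nsnd A).
exact: (recin_app2 HP (recin_nfst A) (recin_comp (recin_nfst A) (recin_nsnd A))).
Qed.

Lemma recin_bexn b (P : nat -> nat -> bool) : recin A b ->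
  recin2 A (fun n i => nat_of_bool (P n i)) -> recin A (fun n => nat_of_bool (bexn (b n) (P n))).
Proof.
move=> Hb HP.
apply: (@recin_ext _ (fun n => nat_of_bool (~~ balln (b n) (fun i => ~~ P n i)))).
  by move=> n; rewrite /balln /bexn -has_predC; congr nat_of_bool; apply: eq_has => i /=; rewrite negbK.
by apply: recin_neg; apply: (recin_balln (P := fun n i => ~~ P n i)) => //; apply: recin_neg.
Qed.

Lemma recin_div f g : recin A f -> recin A g -> recin A (fun n => f n %/ g n).
Proof.
move=> Hf Hg.
(* The quotient counts the positive multiples of [g n] up to [f n]; the guard yields 0 for a zero
   divisor. *)
apply: (@recin_ext _ (fun n => ssum (f n) (fun i => nat_of_bool ((0 < g n) && (i.+1 * g n <= f n))))).
  move=> n; rewrite /ssum; case: (posnP (g n)) => [->|g0].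
    by rewrite divn0 big1.
  under eq_bigr do rewrite andTb -leq_divRL //.
  have := leq_div (f n) (g n); move: (f n %/ g n); elim: (f n) => [|m IH] d.
    by rewrite leqn0 big_ord0 => /eqP.
  rewrite big_ord_recr /= leq_eqVlt => /orP[/eqP ->|lt].
    rewrite leqnn (eq_bigr (fun=> 1)) => [|i _]; first by rewrite sum1_card card_ord addn1.
    by rewrite ltnS ltnW ?ltn_ord.
  by rewrite IH // leqNgt lt addn0.
apply: (recin_ssum (F := fun n i => nat_of_bool ((0 < g n) && (i.+1 * g n <= f n)))) => //.
have Hg1 := recin_comp Hg (recin_nfst A); have Hf1 := recin_comp Hf (recin_nfst A).
apply: recin_and; apply: recin_leq => //; first exact: recin_const.
by apply: recin_mul => //; apply/recin_succ/recin_nsnd.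
Qed.

Lemma recin_mod f g : recin A f -> recin A g -> recin A (fun n => f n %% g n).
Proof.
move=> Hf Hg; apply: (@recin_ext _ (fun n => f n - f n %/ g n * g n)).
  by move=> n; apply: (@addnI (f n %/ g n * g n)); rewrite -divn_eq subnKC ?leq_divM.
by apply: recin_sub => //; apply: recin_mul => //; apply: recin_div.
Qed.

Lemma recin_odd f : recin A f -> recin A (fun n => nat_of_bool (odd (f n))).
Proof.
move=> Hf; apply: (@recin_ext _ (fun n => f n %% 2)); first by move=> n; rewrite modn2.
by apply: recin_mod => //; apply: recin_const.
Qed.

Lemma recin_half f : recin A f -> recin A (fun n => (f n)./2).
Proof.
move=> Hf; apply: (@recin_ext _ (fun n => f n %/ 2)); first by move=> n; rewrite divn2.
by apply: recin_div => //; apply: recin_const.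
Qed.

End ClosureBounded.

Definition cnt (N : nat) (P : nat -> bool) : nat := ssum N (fun v => P v).

Lemma recin_cnt A f (P : nat -> nat -> bool) : recin A f ->
  recin2 A (fun n v => nat_of_bool (P n v)) -> recin A (fun n => cnt (f n) (P n)).
Proof. by move=> *; apply: recin_ssum. Qed.

(* Hook for the closure lemmas of the recursive functions defined later. *)
Ltac recin_ext_step := fail.

(** Recursiveness follows the syntax of the function; what no other case recognizes is taken to be a
    conditional. *)
Ltac recin_step :=
  lazymatch goal with
  | |- recin2 _ _ => unfold recin2
  | |- recin _ (fun _ => ?c) => apply: recin_const
  | |- recin _ (fun n => n) => apply: recin_id
  | |- recin _ (fun n => nfst (@?f n)) => apply: (recin_comp (recin_nfst _))
  | |- recin _ (fun n => nsnd (@?f n)) => apply: (recin_comp (recin_nsnd _))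
  | |- recin _ nfst => apply: recin_nfst
  | |- recin _ nsnd => apply: recin_nsnd
  | |- recin _ S => apply: recin_succ
  | |- recin _ (fun n => npair (@?f n) (@?g n)) => apply: (recin_pair (f := f) (g := g))
  | |- recin _ (fun n => S (@?f n)) => apply: (recin_succ (f := f))
  | |- recin _ (fun n => predn (@?f n)) => apply: (recin_pred (f := f))
  | |- recin _ (fun n => addn (@?f n) (@?g n)) => apply: (recin_add (f := f) (g := g))
  | |- recin _ (fun n => subn (@?f n) (@?g n)) => apply: (recin_sub (f := f) (g := g))
  | |- recin _ (fun n => muln (@?f n) (@?g n)) => apply: (recin_mul (f := f) (g := g))
  | |- recin _ (fun n => expn (@?f n) (@?g n)) => apply: (recin_exp (f := f) (g := g))
  | |- recin _ (fun n => divn (@?f n) (@?g n)) => apply: (recin_div (f := f) (g := g))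
  | |- recin _ (fun n => modn (@?f n) (@?g n)) => apply: (recin_mod (f := f) (g := g))
  | |- recin _ (fun n => half (@?f n)) => apply: (recin_half (f := f))
  | |- recin _ (fun n => ssum (@?b n) (@?F n)) => apply: (recin_ssum (b := b) (F := F)); cbv beta
  | |- recin _ (fun n => iter (@?b n) (@?F n) (@?f n)) =>
      apply: (recin_iter (b := b) (G := F) (f := f)); cbv beta
  | |- recin _ (fun n => nat_of_bool (asbool (?B (@?f n)))) => apply: (recin_oracle (f := f))
  | |- recin _ (fun n => nat_of_bool (odd (@?f n))) => apply: (recin_odd (f := f))
  | |- recin _ (fun n => nat_of_bool (andb (@?f n) (@?g n))) => apply: (recin_and (P := f) (Q := g))
  | |- recin _ (fun n => nat_of_bool (orb (@?f n) (@?g n))) => apply: (recin_or (P := f) (Q := g))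
  | |- recin _ (fun n => nat_of_bool (implb (@?f n) (@?g n))) => apply: (recin_implb (P := f) (Q := g))
  | |- recin _ (fun n => nat_of_bool (negb (@?f n))) => apply: (recin_neg (P := f))
  | |- recin _ (fun n => nat_of_bool (leq (@?f n) (@?g n))) => apply: (recin_leq (f := f) (g := g))
  | |- recin _ (fun n => nat_of_bool (@eq_op _ (@?f n) (@?g n))) => apply: (recin_eq (f := f) (g := g))
  | |- recin _ (fun n => nat_of_bool (balln (@?b n) (@?F n))) =>
      apply: (recin_balln (b := b) (P := F)); cbv beta
  | |- recin _ (fun n => nat_of_bool (bexn (@?b n) (@?F n))) =>
      apply: (recin_bexn (b := b) (P := F)); cbv beta
  | H : recin ?A ?s |- recin ?A ?s => exact: H
  | H : recin ?A ?s |- recin ?A (fun n => ?s (@?f n)) => apply: (recin_comp H)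
  | H : recin ?A (fun x => nat_of_bool (?s x)) |- recin ?A (fun n => nat_of_bool (?s (@?f n))) =>
      apply: (recin_comp H)
  | H : recin2 ?A ?F |- recin ?A (fun n => ?F (@?f n) (@?g n)) =>
      apply: (recin_app2 (f := f) (g := g) H)
  | H : recin2 ?A (fun x y => nat_of_bool (?F x y))
    |- recin ?A (fun n => nat_of_bool (?F (@?f n) (@?g n))) =>
      apply: (recin_app2 (f := f) (g := g) H)
  | |- recin _ (fun n => nat_of_bool _) => first [recin_ext_step | apply: recin_ifb]
  | |- _ => first [recin_ext_step | apply: recin_if]
  end; cbv beta.

Ltac solve_recin := repeat recin_step.

(** * Unbounded search, semi-decidable predicates and change of oracle *)

Lemma recin_search A (R : nat -> nat -> bool) (ex : forall n, exists k, R n k) :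
  recin2 A (fun n k => nat_of_bool (R n k)) -> recin A (fun n => ex_minn (ex n)).
Proof.
move=> /recin_neg [c Hc]; exists (Mu c) => n; case: ex_minnP => m Rm min_m.
have H k : prog_eval A c (npair n k) (~~ R n k).
  by have := Hc (npair n k); rewrite nfst_npair nsnd_npair.
apply: (eval_mu (w := fun=> 0)); last by have := H m; rewrite Rm.
by move=> k lt; have := H k; case E : (R n k) => //; have := min_m _ E; lia.
Qed.

(** [Mu] looks for the value 0, so it is applied to the negation of [R]. Describing the output, and
    not only the domain, permits machines whose output carries a halting time. *)
Lemma sigma1_program A (R : nat -> nat -> bool) : recin2 A (fun n k => nat_of_bool (R n k)) ->
  exists c, forall n y, prog_eval A c n y <-> R n y /\ forall k, k < y -> ~~ R n k.
Proof.
move=> /recin_neg [c Hc]; exists (Mu c) => n y.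
have H k : prog_eval A c (npair n k) (~~ R n k).
  by have := Hc (npair n k); rewrite nfst_npair nsnd_npair.
split=> [/prog_eval_inv[w H1 H2]|[Ry min_y]].
  split=> [|k /H1 /(prog_eval_det (H k))]; last by case: (R n k).
  by have := prog_eval_det (H y) H2; case: (R n y).
apply: (eval_mu (w := fun=> 0)); last by have := H y; rewrite Ry.
by move=> k lt; have := H k; rewrite (min_y k lt).
Qed.

Lemma sigma1_halts A (R : nat -> nat -> bool) : recin2 A (fun n k => nat_of_bool (R n k)) ->
  exists c, forall n, halts A c n <-> exists k, R n k.
Proof.
move=> /sigma1_program [c H]; exists c => n; split=> [[y /H [Ry _]]|ex]; first by exists y.
case: (ex_minnP ex) => y Ry min_y; exists y; apply/H; split=> // k lt.
by apply/negP => /min_y; rewrite leqNgt lt.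
Qed.

Fixpoint oracle_subst (d c : prog) : prog :=
  match c with
  | Oracle => d
  | Pair f g => Pair (oracle_subst d f) (oracle_subst d g)
  | Comp f g => Comp (oracle_subst d f) (oracle_subst d g)
  | Prec f g => Prec (oracle_subst d f) (oracle_subst d g)
  | Mu f => Mu (oracle_subst d f)
  | c => c
  end.

Lemma recin_trans A B f : turing_le A B -> recin A f -> recin B f.
Proof.
move=> [d Hd] [c Hc]; exists (oracle_subst d c) => n.
elim: {n f Hc} (Hc n) => /=; try by constructor.
- by move=> *; apply: Hd.
- by move=> *; apply: eval_comp; eauto.
- by move=> *; apply: eval_precS; eauto.
- by move=> *; apply: eval_mu; eauto.
Qed.

Lemma turing_le_recin A B : turing_le A B <-> recin B (fun n => nat_of_bool `[< A n >]).
Proof. by []. Qed.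

Lemma turing_le_trans A B C : turing_le A B -> turing_le B C -> turing_le A C.
Proof. by move=> H /recin_trans; apply. Qed.

(** * Binary digits and initial segments *)

Definition bit (v i : nat) : bool := odd (v %/ 2 ^ i).

Lemma expn2_gt0 s : 0 < 2 ^ s. Proof. by rewrite expn_gt0. Qed.

Lemma modn_exp2S v s : v %% 2 ^ s.+1 = v %% 2 ^ s + bit v s * 2 ^ s.
Proof.
have lt : v %% 2 ^ s + bit v s * 2 ^ s < 2 ^ s.+1.
  by rewrite expnS; have := ltn_pmod v (expn2_gt0 s); case: bit; lia.
rewrite -[RHS](modn_small lt) -[RHS](modnMDl (v %/ 2 ^ s.+1)); congr (_ %% _).
rewrite [LHS](divn_eq v (2 ^ s)) addnCA addnC; congr (_ + _).
rewrite [in LHS](divn_eq (v %/ 2 ^ s) 2) -divnMA modn2 -expnSr mulnDl -mulnA -expnS.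
by [].
Qed.

Lemma bit_modn v s i : bit (v %% 2 ^ s) i = (i < s) && bit v i.
Proof.
case: ltnP => [lt|le] /=; last first.
  rewrite /bit divn_small //; apply: leq_trans (ltn_pmod _ (expn2_gt0 s)) _.
  by rewrite leq_exp2l.
have e : v %/ 2 ^ i = v %/ 2 ^ s * 2 ^ (s - i) + (v %% 2 ^ s) %/ 2 ^ i.
  by rewrite -divnMDl ?expn2_gt0 // -mulnA -expnD subnK ?(ltnW lt) // -divn_eq.
by rewrite /bit e oddD oddM oddX subn_eq0 leqNgt lt /= andbF.
Qed.

Definition restr (Z : set nat) (s : nat) : nat := ssum s (fun i => `[< Z i >] * 2 ^ i).

Lemma restr0 Z : restr Z 0 = 0.
Proof. by rewrite /restr /ssum big_ord0. Qed.

Lemma restrS Z s : restr Z s.+1 = restr Z s + `[< Z s >] * 2 ^ s.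
Proof. by rewrite /restr /ssum big_ord_recr. Qed.

Lemma restr_ltn Z s : restr Z s < 2 ^ s.
Proof. by elim: s => [|s IH]; rewrite ?restr0 // restrS expnS; case: `[< _ >]; lia. Qed.

Lemma restr_bit v s : restr [set i | bit v i] s = v %% 2 ^ s.
Proof.
elim: s => [|s IH]; first by rewrite restr0 modn1.
by rewrite restrS modn_exp2S IH; congr (_ + nat_of_bool _ * _); exact: asboolb.
Qed.

Lemma bit_restr Z s i : bit (restr Z s) i = (i < s) && `[< Z i >].
Proof.
elim: s => [|s IH]; first by rewrite restr0 /bit div0n.
have lt := restr_ltn Z s; rewrite restrS.
case: (ltngtP i s) => [lis|gis|->].
- rewrite ltnS (ltnW lis) /=.
  have -> : bit (restr Z s + `[<Z s>] * 2 ^ s) i = bit ((restr Z s + `[<Z s>] * 2 ^ s) %% 2 ^ s) i.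
    by rewrite bit_modn lis.
  by rewrite addnC modnMDl modn_small // IH lis.
- rewrite ltnS leqNgt gis /= /bit divn_small //.
  by apply: (@leq_trans (2 ^ s.+1)); rewrite ?leq_exp2l // -restrS restr_ltn.
- rewrite ltnSn /bit addnC divnMDl ?expn2_gt0 // divn_small // addn0.
  by case: `[< _ >].
Qed.

Lemma restr_modn Z s t : t <= s -> restr Z s %% 2 ^ t = restr Z t.
Proof.
move=> le; elim: t le => [|t IH] le; first by rewrite modn1 restr0.
by rewrite modn_exp2S IH ?(ltnW le) // bit_restr le restrS.
Qed.

Lemma modn_expn2 v s t : t <= s -> (v %% 2 ^ s) %% 2 ^ t = v %% 2 ^ t.
Proof. by move=> le; rewrite modn_dvdm // dvdn_exp2l. Qed.

Lemma bit_inj s u v : u < 2 ^ s -> v < 2 ^ s -> (forall i, i < s -> bit u i = bit v i) -> u = v.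
Proof.
move=> hu hv e; rewrite -(modn_small hu) -(modn_small hv) -!restr_bit /restr /ssum.
apply: eq_bigr => i _; congr (nat_of_bool _ * _).
by apply/asbool_equiv_eq; rewrite /= e.
Qed.

Lemma recin_bit A f g : recin A f -> recin A g -> recin A (fun n => nat_of_bool (bit (f n) (g n))).
Proof. by move=> Hf Hg; rewrite /bit; solve_recin. Qed.

Lemma recin_restr A f : recin A f -> recin A (fun n => restr A (f n)).
Proof. by move=> Hf; rewrite /restr; solve_recin. Qed.

(** * Certificates of computations *)

Ltac recin_ext_step ::=
  lazymatch goal with
  | |- recin _ (fun n => cnt (@?f n) (@?P n)) => apply: (recin_cnt (f := f) (P := P)); cbv beta
  | |- recin _ (fun n => nat_of_bool (bit (@?f n) (@?g n))) => apply: (recin_bit (f := f) (g := g))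
  | |- recin _ (fun n => restr ?A (@?g n)) => apply: (recin_restr (f := g))
  end.

(* A computation is certified by a list of triples (program, argument, value), each of
   which follows by one rule of [prog_eval] from triples further down the list. *)
Definition triple (c n y : nat) : nat := npair c (npair n y).
Definition tval (d : nat) : nat := nsnd (nsnd d).

Lemma tval_triple c n y : tval (triple c n y) = y.
Proof. by rewrite /tval /triple !nsnd_npair. Qed.

(** The disjuncts are the rules of [prog_eval], in order. [ex P] stands for the presence of an
    earlier triple with [P]; left abstract, it can be [has] on a list or a bounded search in a coded
    list. [k] is what remains of the number [c] once its constructor is removed, and intermediate
    values are read off the triples found. *)
Definition rule (s v : nat) (ex : (nat -> bool) -> bool) (c n y k : nat) : bool :=
  [|| (c == 0) && (y == 0),
      (c == 1) && (y == n.+1),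
      (c == 2) && (y == nfst n),
      (c == 3) && (y == nsnd n),
      [&& c == 4, n < s & y == bit v n],
      [&& c == 5 + 4 * k,
          ex (fun d => d == triple (nfst k) n (nfst y)) & ex (fun d => d == triple (nsnd k) n (nsnd y))],
      (c == 6 + 4 * k) &&
        ex (fun d => (d == triple (nsnd k) n (tval d)) &&
                     ex (fun d' => d' == triple (nfst k) (tval d) y)),
      [&& c == 7 + 4 * k, nsnd n == 0 & ex (fun d => d == triple (nfst k) (nfst n) y)],
      [&& c == 7 + 4 * k, nsnd n != 0 &
        ex (fun d => (d == triple c (npair (nfst n) (nsnd n).-1) (tval d)) &&
                     ex (fun d' => d' == triple (nsnd k) (npair (nfst n) (npair (nsnd n).-1 (tval d))) y))] |
      [&& c == 8 + 4 * k, ex (fun d => d == triple k (npair n y) 0) &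
        balln y (fun j => ex (fun d => (d == triple k (npair n j) (tval d)) && (0 < tval d)))]].

Definition just (s v : nat) (ex : (nat -> bool) -> bool) (e : nat) : bool :=
  rule s v ex (nfst e) (nfst (nsnd e)) (tval e) ((nfst e - 5) %/ 4).

Fixpoint valid_seq (s v : nat) (E : seq nat) : bool :=
  if E is e :: E' then just s v (fun P => has P E') e && valid_seq s v E' else true.

Definition agree (s v : nat) (A : set nat) : Prop :=
  forall i, i < s -> bit v i = `[< A i >].

Lemma agree_restr s A : agree s (restr A s) A.
Proof. by move=> i lt; rewrite bit_restr lt. Qed.

Lemma rule_mono s v s' v' (S S' : seq nat) c n y k :
  s <= s' -> (forall i, i < s -> bit v i = bit v' i) -> {subset S <= S'} ->
  rule s v (fun P => has P S) c n y k -> rule s' v' (fun P => has P S') c n y k.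
Proof.
move=> les ev sub.
have sub_has (P Q : nat -> bool) : (forall d, P d -> Q d) -> has P S -> has Q S'.
  by move=> PQ /hasP[d /sub dS' /PQ Qd]; apply/hasP; exists d.
have subS P : has P S -> has P S' by exact: sub_has.
rewrite /rule; do 9?[case/orP]; move=> H.
- by rewrite H.
- by rewrite H !orbT.
- by rewrite H !orbT.
- by rewrite H !orbT.
- case/and3P: H => -> lt /eqP ->.
  by rewrite (leq_trans lt les) ev // eqxx !orbT.
- by case/and3P: H => -> /subS -> /subS ->; rewrite !orbT.
- case/andP: H => -> h; do 6![apply/orP; right]; apply/orP; left.
  by apply: sub_has h => d /andP[-> /subS].
- by case/and3P: H => -> -> /subS ->; rewrite !orbT.
- case/and3P: H => -> -> h; do 8![apply/orP; right]; apply/orP; left.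
  by apply: sub_has h => d /andP[-> /subS].
- case/and3P: H => -> /subS -> /ballnP h; do 9![apply/orP; right].
  by apply/ballnP => i /h /subS.
Qed.

Lemma valid_seq_mono s v s' v' E : s <= s' -> (forall i, i < s -> bit v i = bit v' i) ->
  valid_seq s v E -> valid_seq s' v' E.
Proof.
move=> le ev; elim: E => //= e E IH /andP[h1 /IH ->]; rewrite andbT.
exact: rule_mono h1.
Qed.

Lemma valid_seq_cat s v E1 E2 : valid_seq s v E1 -> valid_seq s v E2 -> valid_seq s v (E1 ++ E2).
Proof.
move=> h1 h2; elim: E1 h1 => //= e E IH /andP[h /IH ->]; rewrite andbT.
by apply: rule_mono h => // d dE; rewrite mem_cat dE.
Qed.

Definition sound_triple (A : set nat) (e : nat) : Prop :=
  exists2 c, prog_num c = nfst e & prog_eval A c (nfst (nsnd e)) (tval e).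

Lemma sound_triple_triple A c n y :
  sound_triple A (triple c n y) <-> exists2 c', prog_num c' = c & prog_eval A c' n y.
Proof. by rewrite /sound_triple tval_triple /triple !(nfst_npair, nsnd_npair). Qed.

Lemma rule_sound A s v (S : seq nat) c n y k : agree s v A ->
  (forall d, d \in S -> sound_triple A d) ->
  rule s v (fun P => has P S) c n y k -> exists2 c', prog_num c' = c & prog_eval A c' n y.
Proof.
move=> ag sound.
have hasS (P : nat -> bool) : has P S -> exists2 d, P d & sound_triple A d.
  by move=> /hasP[d /sound ? ?]; exists d.
have memS c' n' y' : has (fun d => d == triple c' n' y') S ->
    exists2 c'', prog_num c'' = c' & prog_eval A c'' n' y'.
  by move=> /hasS[_ /eqP -> /sound_triple_triple].
rewrite /rule; do 9?[case/orP].
- by move=> /andP[/eqP -> /eqP ->]; exists Zero => //; constructor.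
- by move=> /andP[/eqP -> /eqP ->]; exists Succ => //; constructor.
- by move=> /andP[/eqP -> /eqP ->]; exists Fst => //; rewrite -{1}(npair_eta n); constructor.
- by move=> /andP[/eqP -> /eqP ->]; exists Snd => //; rewrite -{1}(npair_eta n); constructor.
- by move=> /and3P[/eqP -> /ag -> /eqP ->]; exists Oracle => //; constructor.
- move=> /and3P[/eqP -> /memS[f ef Hf] /memS[g eg Hg]]; exists (Pair f g).
    by rewrite /= ef eg npair_eta.
  by rewrite -(npair_eta y); constructor.
- move=> /andP[/eqP -> /hasS[d /andP[/eqP -> /memS[f ef Hf]]]].
  move=> /sound_triple_triple[g eg Hg]; exists (Comp f g); first by rewrite /= ef eg npair_eta.
  by apply: eval_comp Hg _; move: Hf; rewrite tval_triple.
- move=> /and3P[/eqP -> /eqP n0 /memS[f ef Hf]].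
  (* [Prec] at 0 certifies only its base program; surjectivity of the numbering supplies the other
     component. *)
  have [g eg] := prog_num_surj (nsnd k).
  exists (Prec f g); first by rewrite /= ef eg npair_eta.
  by rewrite -(npair_eta n) n0; constructor.
- move=> /and3P[/eqP -> n0 /hasS[d /andP[/eqP -> /memS[g eg Hg]]]].
  move=> /sound_triple_triple[c' ec' Hc'].
  have [f ef] := prog_num_surj (nfst k).
  (* The earlier triple knows its program by number only; injectivity makes it the very
     [Prec f g]. *)
  have ec : c' = Prec f g by apply: prog_num_inj; rewrite ec' /= ef eg npair_eta.
  subst c'; exists (Prec f g) => //; rewrite -(npair_eta n) -(prednK (n := nsnd n)) ?lt0n //.
  by apply: eval_precS Hc' _; move: Hg; rewrite tval_triple.
- move=> /and3P[/eqP -> /memS[f ef Hf] /ballnP H]; exists (Mu f); first by rewrite /= ef.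
  have {}H i : exists x, i < y -> prog_eval A f (npair n i) x.+1.
    case: (boolP (i < y)) => [lt|_]; last by exists 0.
    have /hasS[d /andP[/eqP -> pos]] := H _ lt.
    move=> /sound_triple_triple[f' ef' Hf']; exists (tval d).-1 => _.
    move: pos; rewrite tval_triple => pos; rewrite prednK //.
    by move: ef'; rewrite -ef => /prog_num_inj <-.
  have /choice[w Hw] := H.
  exact: eval_mu Hw Hf.
Qed.

Lemma valid_seq_sound A s v E : agree s v A -> valid_seq s v E ->
  forall d, d \in E -> sound_triple A d.
Proof.
move=> ag; elim: E => //= e E IH /andP[h /IH {}IH] d.
rewrite in_cons => /orP[/eqP ->|/IH //].
exact: rule_sound h.
Qed.

(** One list must serve all long enough initial segments of the oracle: [m] bounds the use of the
    computation. *)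
Definition provable (A : set nat) (e : nat) : Prop :=
  exists E m, forall s v, m <= s -> agree s v A -> valid_seq s v E && (e \in E).

Lemma just_provable A (S : seq nat) e : (forall d, d \in S -> provable A d) ->
  (exists m, forall s v, m <= s -> agree s v A -> just s v (fun P => has P S) e) ->
  provable A e.
Proof.
move=> HS [m0 He].
have [E [m HE]] : exists E m, forall s v, m <= s -> agree s v A ->
    valid_seq s v E /\ {subset S <= E}.
  elim: S HS {He} => [|d S IH] HS; first by exists [::], 0.
  have [|E [m HE]] := IH; first by move=> d' Sd'; apply: HS; rewrite in_cons Sd' orbT.
  have [E' [m' HE']] := HS d (mem_head _ _).
  exists (E ++ E'), (maxn m m') => s v; rewrite geq_max => /andP[le le'] ag.
  have [h1 h2] := HE s v le ag; have /andP[h1' h2'] := HE' s v le' ag.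
  split=> [|x]; first exact: valid_seq_cat.
  by rewrite in_cons mem_cat => /orP[/eqP ->|/h2 ->//]; rewrite h2' orbT.
exists (e :: E), (maxn m m0) => s v; rewrite geq_max => /andP[le le'] ag.
have [h1 h2] := HE s v le ag; rewrite mem_head andbT /= h1 andbT.
by apply: rule_mono h2 (He s v le' ag).
Qed.

Lemma just_triple s v ex c n y :
  just s v ex (triple c n y) = rule s v ex c n y ((c - 5) %/ 4).
Proof. by rewrite /just tval_triple /triple !(nfst_npair, nsnd_npair). Qed.

Lemma prog_eval_provable A c n y : prog_eval A c n y -> provable A (triple (prog_num c) n y).
Proof.
have code r k : r < 4 -> (5 + r + 4 * k - 5) %/ 4 = k by lia.
elim=> {c n y}.
- move=> n; apply: (@just_provable A [::]) => //; exists 0 => s v _ _.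
  by rewrite just_triple /rule.
- move=> n; apply: (@just_provable A [::]) => //; exists 0 => s v _ _.
  by rewrite just_triple /rule !eqxx !orbT.
- move=> m n; apply: (@just_provable A [::]) => //; exists 0 => s v _ _.
  by rewrite just_triple /rule nfst_npair !eqxx !orbT.
- move=> m n; apply: (@just_provable A [::]) => //; exists 0 => s v _ _.
  by rewrite just_triple /rule nsnd_npair !eqxx !orbT.
- move=> n; apply: (@just_provable A [::]) => //; exists n.+1 => s v lt ag.
  by rewrite just_triple /rule ag ?lt // !eqxx !orbT.
- move=> f g n x y _ IH1 _ IH2.
  apply: (@just_provable A [:: triple (prog_num f) n x; triple (prog_num g) n y]).
    by move=> d; rewrite !inE => /orP[] /eqP ->.
  exists 0 => s v _ _; rewrite just_triple /rule (code 0) // !(nfst_npair, nsnd_npair).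
  by rewrite /= !eqxx !orbT.
- move=> f g n x y _ IH1 _ IH2.
  apply: (@just_provable A [:: triple (prog_num g) n x; triple (prog_num f) x y]).
    by move=> d; rewrite !inE => /orP[] /eqP ->.
  exists 0 => s v _ _; rewrite just_triple /rule (code 1) // !(nfst_npair, nsnd_npair).
  do 6![apply/orP; right]; apply/orP; left; rewrite eqxx.
  by rewrite /= !tval_triple !eqxx !orbT.
- move=> f g a y _ IH.
  apply: (@just_provable A [:: triple (prog_num f) a y]).
    by move=> d; rewrite !inE => /eqP ->.
  exists 0 => s v _ _; rewrite just_triple /rule (code 2) // !(nfst_npair, nsnd_npair).
  by rewrite /= !eqxx !orbT.
- move=> f g a m x y _ IH1 _ IH2.
  apply: (@just_provable A [:: triple (prog_num (Prec f g)) (npair a m) x;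
      triple (prog_num g) (npair a (npair m x)) y]).
    by move=> d; rewrite !inE => /orP[] /eqP ->.
  exists 0 => s v _ _; rewrite just_triple /rule (code 2) // !(nfst_npair, nsnd_npair).
  do 8![apply/orP; right]; apply/orP; left; rewrite eqxx.
  by rewrite /= !tval_triple !eqxx !orbT.
- move=> f a m w _ IH1 _ IH2.
  apply: (@just_provable A (triple (prog_num f) (npair a m) 0 ::
      [seq triple (prog_num f) (npair a k) (w k).+1 | k <- iota 0 m])).
    move=> d; rewrite !inE => /orP[/eqP -> //|/mapP[k]].
    by rewrite mem_iota => /IH1 ? ->.
  exists 0 => s v _ _; rewrite just_triple /rule (code 3) //.
  do 9![apply/orP; right]; rewrite eqxx /= eqxx /=.
  apply/ballnP => k lt; apply/orP; right; apply/hasP.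
  exists (triple (prog_num f) (npair a k) (w k).+1); last by rewrite tval_triple eqxx.
  by apply/mapP; exists k => //; rewrite mem_iota.
Qed.

(** A list is coded by nested pairs, with its length kept separately. *)
Definition entry (l i : nat) : nat := nfst (iter i nsnd l).

Definition valid (s v w : nat) : bool :=
  balln (nfst w) (fun i => just s v
    (fun P => bexn (nfst w) (fun j => (i < j) && P (entry (nsnd w) j))) (entry (nsnd w) i)).

(* [eval_stage s v c n y]: a certificate below [s] shows that program number [c] maps [n] to [y],
   with the first [s] bits of [v] as oracle. *)
Definition eval_stage (s v c n y : nat) : bool :=
  bexn s (fun w => valid s v w && bexn (nfst w) (fun i => entry (nsnd w) i == triple c n y)).

(** The stage bounds the certificate and the value alike, which keeps the predicate decidable and
    lets a halting stage bound the output. *)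
Definition halt (s v c n : nat) : bool := bexn s (eval_stage s v c n).

Lemma valid_seqP s v (E : seq nat) : valid_seq s v E =
  balln (size E) (fun i => just s v (fun P => has P (drop i.+1 E)) (nth 0 E i)).
Proof.
elim: E => //= e E ->; rewrite /balln /= drop0; congr (_ && _).
by rewrite -[1]addn0 iotaDl all_map.
Qed.

Lemma valid_mkseq s v w : valid s v w = valid_seq s v (mkseq (entry (nsnd w)) (nfst w)).
Proof.
rewrite valid_seqP size_mkseq /valid /balln; apply: eq_in_all => i.
rewrite mem_iota add0n => /andP[_ lt]; rewrite nth_mkseq //; congr just; apply/funext => P.
apply/bexnP/hasP => [[j ltj /andP[ij Pj]]|[d]].
  exists (entry (nsnd w) j) => //.
  rewrite -(nth_mkseq 0 (entry (nsnd w)) ltj) -{1}(subnKC ij) -nth_drop.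
  by rewrite mem_nth // size_drop size_mkseq ltn_sub2r // (leq_ltn_trans ij).
move=> /(nthP 0)[j]; rewrite size_drop size_mkseq nth_drop => ltj.
have lt' : i.+1 + j < nfst w by lia.
by rewrite nth_mkseq // => <- Pd; exists (i.+1 + j) => //; rewrite Pd andbT; lia.
Qed.

Lemma entry_foldr (E : seq nat) : mkseq (entry (foldr npair 0 E)) (size E) = E.
Proof.
apply: (@eq_from_nth _ 0); rewrite size_mkseq // => i lt; rewrite nth_mkseq // /entry.
by elim: E i lt => //= e E IH [|i] lt; rewrite ?nfst_npair // iterSr nsnd_npair IH.
Qed.

Lemma eval_stage_mono s v s' v' c n y : s <= s' -> (forall i, i < s -> bit v i = bit v' i) ->
  eval_stage s v c n y -> eval_stage s' v' c n y.
Proof.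
move=> le ev /bexnP[w lt /andP[h1 h2]]; apply/bexnP; exists w; first exact: leq_trans le.
by rewrite h2 andbT valid_mkseq; apply: valid_seq_mono le ev _; rewrite -valid_mkseq.
Qed.

Lemma halt_mono s v s' v' c n : s <= s' -> (forall i, i < s -> bit v i = bit v' i) ->
  halt s v c n -> halt s' v' c n.
Proof.
move=> le ev /bexnP[y lt h]; apply/bexnP; exists y; first exact: leq_trans le.
exact: eval_stage_mono h.
Qed.

Lemma eval_stage_sound A s v c n y : agree s v A -> eval_stage s v (prog_num c) n y -> prog_eval A c n y.
Proof.
move=> ag /bexnP[w lt /andP[]]; rewrite valid_mkseq => h /bexnP[i lti /eqP e].
suff /(valid_seq_sound ag h)/sound_triple_triple[c' /prog_num_inj <- //] :
  triple (prog_num c) n y \in mkseq (entry (nsnd w)) (nfst w).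
by rewrite -e; apply/mapP; exists i => //; rewrite mem_iota.
Qed.

Lemma eval_stage_complete A c n y : prog_eval A c n y ->
  exists m, forall s v, m <= s -> agree s v A -> eval_stage s v (prog_num c) n y.
Proof.
move=> /prog_eval_provable[E [m HE]].
(* The stage must exceed both the use [m] and the code of the certificate. *)
exists (maxn m (npair (size E) (foldr npair 0 E)).+1) => s v; rewrite geq_max => /andP[le lt] ag.
have /andP[h1 h2] := HE s v le ag.
apply/bexnP; exists (npair (size E) (foldr npair 0 E)) => //.
rewrite valid_mkseq !(nfst_npair, nsnd_npair) entry_foldr h1 /=.
move: h2; rewrite -{1}(entry_foldr E) => /mapP[i]; rewrite mem_iota => /andP[_ lti] ->.
by apply/bexnP; exists i.
Qed.

Lemma halts_halt A c n : halts A c n <-> exists s, halt s (restr A s) (prog_num c) n.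
Proof.
split=> [[y /eval_stage_complete[m H]]|[s /bexnP[y _ /eval_stage_sound h]]]; last first.
  by exists y; apply: h; apply: agree_restr.
exists (maxn m y.+1); apply/bexnP; exists y; first exact: leq_maxr.
by apply: H; [exact: leq_maxl|exact: agree_restr].
Qed.

Section ClosureEval.
Variables (A : set nat) (fs fv fc fn fy : nat -> nat).
Hypotheses (Hs : recin A fs) (Hv : recin A fv) (Hc : recin A fc) (Hn : recin A fn) (Hy : recin A fy).

Lemma recin_eval_stage : recin A (fun n => nat_of_bool (eval_stage (fs n) (fv n) (fc n) (fn n) (fy n))).
Proof. by rewrite /eval_stage /valid /just /rule /entry /triple /tval; solve_recin. Qed.

End ClosureEval.

Lemma recin_halt A fs fv fc fn : recin A fs -> recin A fv -> recin A fc -> recin A fn ->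
  recin A (fun n => nat_of_bool (halt (fs n) (fv n) (fc n) (fn n))).
Proof. by move=> *; rewrite /halt; apply: recin_bexn => //; apply: recin_eval_stage; solve_recin. Qed.

Ltac recin_ext_step ::=
  lazymatch goal with
  | |- recin _ (fun n => cnt (@?f n) (@?P n)) => apply: (recin_cnt (f := f) (P := P)); cbv beta
  | |- recin _ (fun n => nat_of_bool (bit (@?f n) (@?g n))) => apply: (recin_bit (f := f) (g := g))
  | |- recin _ (fun n => restr ?A (@?g n)) => apply: (recin_restr (f := g))
  | |- recin _ (fun n => nat_of_bool (eval_stage (@?f n) (@?g n) (@?h n) (@?k n) (@?l n))) =>
     apply: (recin_eval_stage (fs := f) (fv := g) (fc := h) (fn := k) (fy := l))
  | |- recin _ (fun n => nat_of_bool (halt (@?f n) (@?g n) (@?h n) (@?k n))) =>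
     apply: (recin_halt (fs := f) (fv := g) (fc := h) (fn := k))
  end.

(** * Jumps and Koenig's lemma *)

Definition const_prog (n : nat) : prog := iter n (Comp Succ) Zero.

Lemma eval_const_prog A k n : prog_eval A (const_prog k) n k.
Proof. by elim: k => [|k IH]; [constructor|apply: eval_comp IH _; constructor]. Qed.

Lemma prog_num_const_prog k : prog_num (const_prog k) = iter k (fun m => 6 + 4 * npair 1 m) 0.
Proof. by elim: k => //= k ->. Qed.

(* The s-m-n theorem: [n] is hard-wired by composition with [const_prog n]. *)
Lemma sigma1_le_jump B (R : nat -> nat -> bool) : recin2 B (fun n k => nat_of_bool (R n k)) ->
  turing_le [set n | exists k, R n k] (jump B).
Proof.
move=> /sigma1_halts[c Hc].
pose g n := 6 + 4 * npair (prog_num c) (iter n (fun m => 6 + 4 * npair 1 m) 0).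
have eg n : g n = prog_num (Comp c (const_prog n)) by rewrite /= prog_num_const_prog.
suff E n : [set n | exists k, R n k] n <-> jump B (g n).
  apply/turing_le_recin; apply: (@recin_ext _ (fun n => nat_of_bool `[<jump B (g n)>])).
    by move=> n; congr nat_of_bool; apply/asbool_equiv_eq; rewrite E.
  by rewrite /g; solve_recin.
rewrite /= -Hc eg; split=> [[y Hy]|[c' /prog_num_inj ->]].
  exists (Comp c (const_prog n)) => //; exists y.
  by apply: eval_comp Hy; apply: eval_const_prog.
move=> [y /prog_eval_inv[x Hx Hy]]; exists y.
by rewrite (prog_eval_det (eval_const_prog B n _) Hx).
Qed.

Lemma recin_pi1 B (R : nat -> nat -> bool) : recin2 B (fun n k => nat_of_bool (R n k)) ->
  recin (jump B) (fun n => nat_of_bool `[< forall k, R n k >]).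
Proof.
move=> HR; have := sigma1_le_jump (R := fun n k => ~~ R n k) (recin_neg HR).
move=> /turing_le_recin /recin_neg; apply: recin_ext => n; congr nat_of_bool.
rewrite -asbool_neg; apply/asbool_equiv_eq => /=.
split=> [H k|H [k]]; last by rewrite H.
by apply/negPn/negP => Rk; apply: H; exists k.
Qed.

Lemma jump_halt A e : jump A e <-> exists s, halt s (restr A s) e e.
Proof.
split=> [[c <- /halts_halt //]|]; have [c <-] := prog_num_surj e.
by move=> /halts_halt; exists c.
Qed.

Lemma le_jump B : turing_le B (jump B).
Proof.
have : recin2 B (fun n _ => nat_of_bool `[<B n>]) by solve_recin.
move=> /sigma1_le_jump; congr turing_le; apply/seteqP; split=> n /=.
  by move=> [_ /asboolP].
by exists 0; apply/asboolP.
Qed.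

Lemma restr_set0 s : restr set0 s = 0.
Proof. by rewrite /restr /ssum big1 // => i _; rewrite asboolF. Qed.

Lemma jump_set0_le X : turing_le (jump set0) (jump X).
Proof.
have : recin2 X (fun e s => nat_of_bool (halt s 0 e e)) by solve_recin.
move=> /sigma1_le_jump; congr turing_le; apply/seteqP; split=> e.
  by move=> [s h]; apply/jump_halt; exists s; rewrite restr_set0.
by move=> /jump_halt[s]; rewrite restr_set0 => h; exists s.
Qed.

(** The strings with extensions in [D] of every length form a tree without dead ends, in which the
    path takes the digit 0 whenever it can. *)
Lemma koenig (D : nat -> nat -> Prop) :
  (forall s v, v < 2 ^ s.+1 -> D s.+1 v -> D s (v %% 2 ^ s)) ->
  (forall s, exists2 v, v < 2 ^ s & D s v) ->
  exists Z, forall s, D s (restr Z s).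
Proof.
move=> down ex.
have downs s t v : s <= t -> v < 2 ^ t -> D t v -> D s (v %% 2 ^ s).
  move=> le lt Dv; have {lt} lev : v %% 2 ^ t = v by rewrite modn_small.
  have : forall j, j <= t - s -> D (t - j) (v %% 2 ^ (t - j)).
    elim=> [_|j IH ltj]; first by rewrite subn0 lev.
    have e : t - j = (t - j.+1).+1 by lia.
    have := IH (ltnW ltj); rewrite e => /(down _ _ (ltn_pmod _ (expn2_gt0 _))).
    by rewrite modn_expn2.
  by move=> /(_ _ (leqnn _)); rewrite subKn.
pose big s v := forall t, s <= t -> exists u, [/\ u < 2 ^ t, u %% 2 ^ s = v & D t u].
have big_next s v : big s v -> big s.+1 v \/ big s.+1 (v + 2 ^ s).
  move=> H; apply: contrapT => /not_orP[].
  move=> /existsNP[t1 /not_implyP[le1 n1]] /existsNP[t2 /not_implyP[le2 n2]].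
  have [|u [ltu eu Du]] := H (maxn t1 t2).
    by apply: leq_trans (leq_maxl _ _); apply: ltnW.
  have := modn_exp2S u s; rewrite eu.
  have key t : s < t -> t <= maxn t1 t2 ->
      exists u', [/\ u' < 2 ^ t, u' %% 2 ^ s.+1 = u %% 2 ^ s.+1 & D t u'].
    move=> lt le; exists (u %% 2 ^ t); split; first exact: ltn_pmod (expn2_gt0 _).
      exact: modn_expn2.
    exact: downs Du.
  case: (bit u s) => e.
    apply: n2; have [u' [? e' ?]] := key t2 le2 (leq_maxr _ _).
    by exists u'; rewrite e' e mul1n.
  apply: n1; have [u' [? e' ?]] := key t1 le1 (leq_maxl _ _).
  by exists u'; rewrite e' e mul0n addn0.
pose f := fix f s := if s is s'.+1 then
  (if `[< big s'.+1 (f s') >] then f s' else f s' + 2 ^ s') else 0.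
have big_f s : big s (f s).
  elim: s => [|s IH] /=.
    by move=> t _; have [u ltu Du] := ex t; exists u; rewrite modn1.
  by case: asboolP => // nb; case: (big_next _ _ IH).
pose Z := [set s | ~ big s.+1 (f s)].
have f_restr s : f s = restr Z s.
  elim: s => [|s IH]; first by rewrite restr0.
  rewrite restrS -IH /=; case: (pselect (big s.+1 (f s))) => h.
    by rewrite asboolT // asboolF ?addn0 //= => ?.
  by rewrite asboolF // asboolT ?mul1n.
exists Z => s; have [u [ltu eu Du]] := big_f s s (leqnn s).
by rewrite -f_restr -eu modn_small.
Qed.

(** * Counting and Kraft's inequality *)

Lemma ssumD a b F : ssum (a + b) F = ssum a F + ssum b (fun i => F (a + i)).
Proof. by rewrite /ssum big_split_ord. Qed.

Lemma ssum_mul a b F : ssum (a * b) F = ssum b (fun j => ssum a (fun u => F (u + a * j))).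
Proof.
elim: b => [|b IH]; first by rewrite muln0 /ssum !big_ord0.
rewrite mulnS addnC ssumD IH [RHS]/ssum big_ord_recr /=; congr (_ + _).
by apply: eq_bigr => i _; rewrite addnC.
Qed.

Lemma eq_ssum N F G : (forall i, i < N -> F i = G i) -> ssum N F = ssum N G.
Proof. by move=> e; apply: eq_bigr => i _; apply: e. Qed.

Lemma leq_ssum N F G : (forall i, i < N -> F i <= G i) -> ssum N F <= ssum N G.
Proof. by move=> e; apply: leq_sum => i _; apply: e. Qed.

Lemma ssum_const N c : ssum N (fun=> c) = N * c.
Proof. by rewrite /ssum sum_nat_const card_ord. Qed.

Lemma exchange_ssum M N (F : nat -> nat -> nat) :
  ssum M (fun i => ssum N (F i)) = ssum N (fun j => ssum M (F^~ j)).
Proof. exact: exchange_big. Qed.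

Lemma leq_cnt N (P Q : nat -> bool) : (forall v, v < N -> P v -> Q v) -> cnt N P <= cnt N Q.
Proof.
by move=> PQ; apply: leq_ssum => v lt; case E : (P v) => //; rewrite PQ.
Qed.

Lemma eq_cnt N (P Q : nat -> bool) : (forall v, v < N -> P v = Q v) -> cnt N P = cnt N Q.
Proof. by move=> PQ; apply: eq_ssum => v lt; rewrite PQ. Qed.

Lemma cnt_pred1 N u : u < N -> cnt N (fun v => v == u) = 1.
Proof.
move=> lt; rewrite /cnt /ssum (bigD1 (Ordinal lt)) //= eqxx big1 // => i.
by rewrite -val_eqE /= => /negbTE ->.
Qed.

Lemma cnt_leq N (P : nat -> bool) : cnt N P <= N.
Proof.
apply: (@leq_trans (ssum N (fun=> 1))); last by rewrite ssum_const muln1.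
by apply: leq_ssum => v _; case: (P v).
Qed.

Lemma cntC N (P : nat -> bool) : cnt N P + cnt N (fun v => ~~ P v) = N.
Proof.
rewrite /cnt /ssum -big_split -[RHS]muln1 -[N in RHS]card_ord -sum_nat_const.
by apply: eq_bigr => i _; case: (P i).
Qed.

Lemma cnt_gt0P N (P : nat -> bool) : 0 < cnt N P -> exists2 v, v < N & P v.
Proof.
rewrite /cnt /ssum lt0n sum_nat_eq0 negb_forall => /existsP[i].
by rewrite eqb0 negbK => Pi; exists i.
Qed.

Lemma cnt_inj M N (P Q : nat -> bool) (f : nat -> nat) :
  (forall v, v < M -> P v -> f v < N /\ Q (f v)) ->
  (forall u v, u < M -> v < M -> P u -> P v -> f u = f v -> u = v) ->
  cnt M P <= cnt N Q.
Proof.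
move=> fQ f_inj.
have cntE K (S : nat -> bool) : cnt K S = count S (iota 0 K).
  rewrite -sum1_count big_mkcond /cnt /ssum -(big_mkord xpredT (fun i => nat_of_bool (S i))).
  by rewrite /index_iota subn0; apply: eq_bigr => i _; case: (S i).
rewrite !cntE -!size_filter -(size_map f); apply: uniq_leq_size.
  rewrite map_inj_in_uniq ?filter_uniq ?iota_uniq // => u v.
  by rewrite !mem_filter !mem_iota => /and3P[? _ ?] /and3P[? _ ?]; apply: f_inj.
move=> w /mapP[v]; rewrite mem_filter mem_iota => /and3P[Pv _ ltv] ->.
by rewrite mem_filter mem_iota; have [-> ->] := fQ v ltv Pv.
Qed.

(** Each string of length [s] has [2 ^ (L - s)] extensions of length [L], so the measure of a clopen
    set can be counted at any resolution. *)
Lemma cnt_modn s L (P : nat -> bool) : s <= L ->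
  cnt (2 ^ L) (fun v => P (v %% 2 ^ s)) = 2 ^ (L - s) * cnt (2 ^ s) P.
Proof.
move=> le; rewrite /cnt -[in LHS](subnKC le) expnD ssum_mul -ssum_const.
apply: eq_ssum => j _; apply: eq_ssum => u lt.
by rewrite addnC mulnC modnMDl modn_small.
Qed.

(** * Strings, their numbers and their cylinders *)

Fixpoint str_val (s : seq bool) : nat := if s is b :: s' then b + (str_val s').*2 else 0.

(** Bijective numeration shifted by one is ordinary binary with a top digit 1 marking the length.
    Hence [v %% 2 ^ j + 2 ^ j - 1] is the number of the string of the first [j] digits of [v]. *)
Lemma str_numE s : (str_num s).+1 = str_val s + 2 ^ size s.
Proof. by elim: s => //= b s IH; rewrite expnS; lia. Qed.

Lemma str_val_ltn s : str_val s < 2 ^ size s.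
Proof. by elim: s => //= b s IH; rewrite expnS; case: b; lia. Qed.

Lemma bit_str_val s i : bit (str_val s) i = nth false s i.
Proof.
elim: s i => [|b s IH] [|i] //=; rewrite /bit ?div0n //.
  by rewrite divn1 oddD odd_double addbF; case: b.
rewrite expnS divnMA -muln2 addnC divnMDl // [b %/ 2]divn_small ?addn0; last by case: b.
exact: IH.
Qed.

Lemma str_num_surj n : exists s, str_num s = n.
Proof.
elim/ltn_ind: n => -[|n] IH; first by exists [::].
have lt : n./2 < n.+1 by rewrite ltnS; lia.
have [s es] := IH _ lt; exists (odd n :: s).
by rewrite /= es; have := odd_double_half n; lia.
Qed.

Lemma str_num_inj : injective str_num.
Proof.
elim=> [|b s IH] [|c t] //= e; try lia.
by congr cons; [case: b c e => [] []; lia|apply: IH; case: b c e => [] []; lia].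
Qed.

Lemma str_of_level l u : u < 2 ^ l -> exists2 s, size s = l & str_val s = u.
Proof.
move=> lt; exists (mkseq (bit u) l); first exact: size_mkseq.
apply: (@bit_inj l) => //; first by have := str_val_ltn (mkseq (bit u) l); rewrite size_mkseq.
by move=> i lti; rewrite bit_str_val nth_mkseq.
Qed.

Definition starts (s : seq bool) (v : nat) : bool := v %% 2 ^ size s == str_val s.

Lemma startsP s v : reflect (forall i, i < size s -> nth false s i = bit v i) (starts s v).
Proof.
apply: (iffP eqP) => [e i lt|H]; first by rewrite -bit_str_val -e bit_modn lt.
apply: (@bit_inj (size s)); [exact: ltn_pmod (expn2_gt0 _)|exact: str_val_ltn|].
by move=> i lt; rewrite bit_modn lt bit_str_val H.
Qed.

Lemma starts_modn s v L : size s <= L -> starts s (v %% 2 ^ L) = starts s v.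
Proof. by move=> le; rewrite /starts modn_expn2. Qed.

Lemma starts_prefix p q v : starts p v -> starts q v -> size p <= size q -> prefix p q.
Proof.
move=> /startsP hp /startsP hq le; rewrite prefixE; apply/eqP.
apply: (@eq_from_nth _ false) => [|i]; rewrite size_takel // => lt.
by rewrite nth_take // hq ?hp // (leq_trans lt le).
Qed.

Lemma prefix_starts p q v : prefix p q -> starts q v -> starts p v.
Proof.
rewrite prefixE => /eqP e /startsP hq; apply/startsP => i lt.
have le : size p <= size q by rewrite -e size_take; case: ltnP => // /ltnW.
by rewrite -hq ?(leq_trans lt le) // -[in LHS]e nth_take.
Qed.

Lemma cylinderE s Z L : size s <= L -> cylinder s Z <-> starts s (restr Z L).
Proof.
move=> le; split=> [H|/startsP H i lt].
  by apply/startsP => i lt; rewrite bit_restr (leq_trans lt le) H.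
by rewrite H // bit_restr (leq_trans lt le).
Qed.

Lemma cnt_starts s L : size s <= L -> cnt (2 ^ L) (starts s) = 2 ^ (L - size s).
Proof.
move=> le; rewrite /starts (cnt_modn (fun v => v == str_val s) le).
by rewrite cnt_pred1 ?str_val_ltn ?muln1.
Qed.

(** For strings of length at most [L] this is [2 ^ L] times the Kraft sum. *)
Definition weight (L : nat) (F : seq (seq bool)) : nat := \sum_(s <- F) 2 ^ (L - size s).

Lemma weight_count L F : {in F, forall s, size s <= L} ->
  weight L F = ssum (2 ^ L) (fun v => count (starts^~ v) F).
Proof.
move=> le; rewrite /weight /ssum.
under [RHS]eq_bigr do rewrite -sum1_count big_mkcond /=.
rewrite exchange_big /= big_seq [RHS]big_seq; apply: eq_bigr => s /le {}le.
rewrite -(cnt_starts le); apply: eq_bigr => v _; by case: starts.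
Qed.

Lemma cnt_le_weight L F : {in F, forall s, size s <= L} ->
  cnt (2 ^ L) (fun v => has (starts^~ v) F) <= weight L F.
Proof.
by move=> le; rewrite weight_count //; apply: leq_ssum => v _; rewrite has_count; case: count.
Qed.

(** Two members starting the same [v] are comparable, hence equal, so each [v] is counted at most
    once: Kraft's inequality before division. *)
Lemma weight_le_cnt L F : {in F, forall s, size s <= L} -> uniq F ->
  {in F &, forall p q, prefix p q -> p = q} ->
  weight L F <= cnt (2 ^ L) (fun v => has (starts^~ v) F).
Proof.
move=> le uF anti; rewrite weight_count //; apply: leq_ssum => v _.
rewrite has_count; case E : (count (fun s => starts s v) F) => [|[|n]] //.
have := E; rewrite -size_filter.
have := filter_uniq (starts^~ v) uF; have : {subset [seq s <- F | starts s v] <= F}.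
  by move=> x; rewrite mem_filter => /andP[].
have : all (starts^~ v) [seq s <- F | starts s v] by exact: filter_all.
case: [seq s <- F | starts s v] => [|p [|q G]] //= /and3P[hp hq _] sub /andP[].
rewrite inE => /norP[/negP npq _] _ _.
have Fp : p \in F by apply: sub; rewrite inE eqxx.
have Fq : q \in F by apply: sub; rewrite !inE eqxx orbT.
case: npq; apply/eqP; case: (leqP (size p) (size q)) => le_pq.
  exact: anti (starts_prefix hp hq le_pq).
exact/esym/(anti _ _ Fq Fp)/(starts_prefix hq hp (ltnW le_pq)).
Qed.

Import Order.TTheory GRing.Theory Num.Theory.

Section RealWeights.
Variable R : realType.
Local Open Scope ring_scope.

Lemma weightE L F : {in F, forall s, (size s <= L)%N} ->
  \sum_(s <- F) 2 ^- size s = (weight L F)%:R / 2 ^+ L :> R.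
Proof.
move=> le; rewrite /weight natr_sum mulr_suml big_seq [RHS]big_seq.
apply: eq_bigr => s /le {}le; rewrite natrX -{2}(subnKC le) exprD invfM mulrCA.
by rewrite mulfV ?mulr1 // expf_neq0 // pnatr_eq0.
Qed.

Lemma esum_weight_ge (C : set (seq bool)) L F : uniq F -> {in F, forall s, C s} ->
  {in F, forall s, (size s <= L)%N} ->
  (((weight L F)%:R / 2 ^+ L : R)%:E <= \esum_(s in C) (2 ^- size s)%:E)%E.
Proof.
move=> uF FC le; apply: esum_ge; exists [set` F].
  by split; [exact: finite_seq|move=> s /= /FC].
by rewrite -fsbig_seq // sumEFin (weightE le).
Qed.

(** The sum is a supremum of finite ones, and finitely many strings have a common length bound
    [L]. *)
Lemma esum_weight_le (C : set (seq bool)) (b : \bar R) :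
  (forall L F, uniq F -> {in F, forall s, C s} -> {in F, forall s, (size s <= L)%N} ->
    (((weight L F)%:R / 2 ^+ L : R)%:E <= b)%E) ->
  (\esum_(s in C) (2 ^- size s)%:E <= b)%E.
Proof.
move=> H; apply: ge_ereal_sup => _ [X [finX XC] <-].
move: finX => /finite_seqP[F0 eX]; set F := undup F0.
have eF : X = [set` F] by rewrite eX; apply/seteqP; split=> x; rewrite /= mem_undup.
have le : {in F, forall s, (size s <= \max_(s <- F) size s)%N}.
  by move=> s Fs; apply: leq_bigmax_seq.
rewrite eF -fsbig_seq ?undup_uniq // sumEFin (weightE le); apply: H => //.
  exact: undup_uniq.
by move=> s Fs; apply: XC; rewrite eF.
Qed.

End RealWeights.

(** * A universal Martin-Loef test *)

Section UniformMeasure.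
Variable R : realType.
Local Open Scope ring_scope.

Lemma dyadic_le a L b M :
  (a%:R / 2 ^+ L <= b%:R / 2 ^+ M :> R) = (a * 2 ^ M <= b * 2 ^ L)%N.
Proof.
have pos n : 0 < 2 ^+ n :> R by rewrite exprn_gt0 // ltr0n.
by rewrite ler_pdivrMr // mulrAC ler_pdivlMr // -!natrX -!natrM ler_nat.
Qed.

(** Compactness: if no finite level sufficed to cover the clopen set of [P], the strings compatible
    with [P] and not yet covered would form an infinite tree, and [koenig] would give a member of
    [S] missed by the cover. *)
Lemma uniform_measure_ge (S : set (set nat)) s (P : nat -> bool) :
  (forall Z, P (restr Z s) -> S Z) ->
  (((cnt (2 ^ s) P)%:R / 2 ^+ s : R)%:E <= uniform_measure R S)%E.
Proof.
move=> PS; apply: le_ereal_inf_tmp => _ [C /= SC <-].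
have [L [le_sL cov]] : exists L, (s <= L)%N /\ forall v, (v < 2 ^ L)%N -> P (v %% 2 ^ s)%N ->
    exists2 p, C p & (size p <= L)%N && starts p v.
  apply: contrapT => no_cov.
  pose D l v := ((s <= l)%N -> P (v %% 2 ^ s)%N) /\ forall p, C p -> (size p <= l)%N -> ~~ starts p v.
  have D_down l m v : (l <= m)%N -> D m v -> D l (v %% 2 ^ l)%N.
    move=> le [h1 h2]; split=> [le_sl|p Cp lep].
      by rewrite modn_expn2 //; apply: h1; apply: leq_trans le.
    by rewrite starts_modn //; apply: h2 => //; apply: leq_trans le.
  have [l v _|l|Z HZ] := @koenig D; first exact: D_down.
    have : ~ forall v, (v < 2 ^ maxn l s)%N -> P (v %% 2 ^ s)%N ->
      exists2 p, C p & (size p <= maxn l s)%N && starts p v.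
      by move=> cov; apply: no_cov; exists (maxn l s); rewrite leq_maxr.
    move=> /existsNP[v /not_implyP[ltv /not_implyP[Pv nv]]].
    exists (v %% 2 ^ l)%N; first exact: ltn_pmod (expn2_gt0 _).
    apply: (D_down l (maxn l s)); first exact: leq_maxl.
    split=> // p Cp le; apply/negP => st; apply: nv; exists p => //.
    by rewrite le.
  have /SC[p Cp] : S Z by apply: PS; have [/(_ (leqnn _))] := HZ s; rewrite modn_small ?restr_ltn.
  move=> /(cylinderE _ (leqnn _)) st.
  by have [_ /(_ p Cp (leqnn _))/negP] := HZ (size p).
(* One covering string is chosen for each of the finitely many [v], so that a finite subsum
   suffices. *)
have /choice[f Hf] : forall v, exists p, (v < 2 ^ L)%N -> P (v %% 2 ^ s)%N ->
    [/\ C p, (size p <= L)%N & starts p v].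
  move=> v; case: (pselect ((v < 2 ^ L)%N /\ P (v %% 2 ^ s)%N)) => [[lt Pv]|n].
    by have [p Cp /andP[? ?]] := cov v lt Pv; exists p.
  by exists [::] => ? ?; case: n.
pose I := [seq v <- iota 0 (2 ^ L) | P (v %% 2 ^ s)%N].
pose F := undup (map f I).
have FP p : p \in F -> exists v, [/\ (v < 2 ^ L)%N, P (v %% 2 ^ s)%N & p = f v].
  rewrite mem_undup => /mapP[v]; rewrite mem_filter mem_iota add0n => /andP[Pv /andP[_ lt]] ->.
  by exists v.
have leF : {in F, forall p, (size p <= L)%N} by move=> p /FP[v [lt Pv ->]]; have [] := Hf v lt Pv.
apply: le_trans (esum_weight_ge R (undup_uniq _) _ leF); last first.
  by move=> p /FP[v [lt Pv ->]]; have [] := Hf v lt Pv.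
rewrite lee_fin dyadic_le -[in (2 ^ L)%N](subnK le_sL) expnD mulnA leq_mul2r.
rewrite mulnC -cnt_modn // orbC; apply/orP; left; apply: leq_trans (cnt_le_weight leF).
apply: leq_cnt => v lt Pv; apply/hasP; exists (f v); last by have [] := Hf v lt Pv.
by rewrite mem_undup map_f // mem_filter Pv mem_iota.
Qed.

Definition covered (C : set (seq bool)) (L v : nat) : bool :=
  `[< exists2 p, C p & (size p <= L)%N && starts p v >].

(* The prefix-minimal elements of [C] cover the same open set. *)
Lemma uniform_measure_le (C : set (seq bool)) (b : \bar R) :
  (forall L, (((cnt (2 ^ L) (covered C L))%:R / 2 ^+ L : R)%:E <= b)%E) ->
  (uniform_measure R (open_of C) <= b)%E.
Proof.
move=> H; pose C' := [set p | C p /\ forall q, C q -> prefix q p -> q = p].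
apply: (@le_trans _ _ (\esum_(p in C') (2 ^- size p)%:E)%E).
  apply: ereal_inf_lbound; exists C' => //= Z [p Cp Zp].
  have [n] := ubnP (size p); elim: n p Cp Zp => // n IH p Cp Zp lt.
  case: (pselect (exists q, [/\ C q, prefix q p & q <> p])) => [[q [Cq qp neq]]|no]; last first.
    exists p => //; split=> // q Cq qp; apply: contrapT => neq; apply: no; by exists q.
  have lt_qp : (size q < size p)%N.
    rewrite ltn_neqAle size_prefix // andbT; apply/negP => /eqP e.
    by apply: neq; move: qp; rewrite prefixE e take_size => /eqP.
  apply: (IH q) => //; last by apply: leq_trans lt_qp _; rewrite -ltnS.
  apply/(cylinderE Z (ltnW lt_qp)); apply: prefix_starts qp _.
  exact/(cylinderE Z (leqnn _)).
apply: esum_weight_le => L F uF FC' leF; apply: le_trans (H L).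
rewrite lee_fin dyadic_le leq_mul2r; apply/orP; right.
apply: leq_trans (weight_le_cnt leF uF _) _.
  by move=> p q Fp Fq pq; have [Cp _] := FC' p Fp; have [_] := FC' q Fq; apply.
apply: leq_cnt => v _ /hasP[p Fp st]; apply/asboolP; exists p.
  by have [] := FC' p Fp.
by rewrite leF.
Qed.

End UniformMeasure.

(** Member [e + 2] of test number [e] as enumerated by stage [s]; [j] is the length of a prefix of
    [v]. The shift by 2 makes the bounds [2 ^- (e + 2)] sum to 1/2. *)
Definition section_stage (e s v : nat) : bool :=
  bexn s.+1 (fun j => halt s 0 e (npair (e + 2) (v %% 2 ^ j + 2 ^ j - 1))).

(* The test number [e] is taken into account only at the stages at which its member
   [e + 2] still has measure at most [2 ^- (e + 2)]. *)
Definition killed (e s v : nat) : bool :=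
  bexn s.+1 (fun t => (cnt (2 ^ t) (section_stage e t) * 2 ^ (e + 2) <= 2 ^ t) &&
                      section_stage e t (v %% 2 ^ t)).

Definition alive (s v : nat) : bool := balln s (fun e => ~~ killed e s v).

Lemma section_stage_mono e s t v : t <= s ->
  section_stage e t (v %% 2 ^ t) -> section_stage e s v.
Proof.
move=> le /bexnP[j lt h]; apply/bexnP; exists j; first by apply: leq_trans lt _.
by move: h; rewrite modn_expn2 //; apply: halt_mono.
Qed.

Lemma killed_mono e s t v : t <= s -> killed e t (v %% 2 ^ t) -> killed e s v.
Proof.
move=> le /bexnP[j lt]; rewrite modn_expn2 // => h; apply/bexnP; exists j => //.
by apply: leq_trans lt _.
Qed.

Lemma alive_mono s t v : t <= s -> alive s v -> alive t (v %% 2 ^ t).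
Proof.
move=> le /ballnP H; apply/ballnP => e lt; apply/negP => /(killed_mono le).
by apply/negP/H; apply: leq_trans lt le.
Qed.

(** The enumeration only grows, so all that is killed by stage [s] lies in the last stage up to [s]
    that was small enough to count. *)
Lemma cnt_killed e s : cnt (2 ^ s) (killed e s) * 2 ^ (e + 2) <= 2 ^ s.
Proof.
pose ok t := (t <= s) && (cnt (2 ^ t) (section_stage e t) * 2 ^ (e + 2) <= 2 ^ t).
case: (pselect (exists t, ok t)) => [ex|no]; last first.
  rewrite (_ : cnt _ _ = 0) //; apply/eqP; rewrite -leqn0 leqNgt; apply/negP.
  move=> /cnt_gt0P[v _ /bexnP[t lt /andP[h _]]]; apply: no; exists t.
  by rewrite /ok h andbT.
have bound t : ok t -> t <= s by case/andP.
case: (ex_maxnP ex bound) => t /andP[le_ts h] max_t.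
apply: (@leq_trans (2 ^ (s - t) * cnt (2 ^ t) (section_stage e t) * 2 ^ (e + 2))).
  rewrite leq_mul2r -cnt_modn //; apply/orP; right; apply: leq_cnt => v _ /bexnP[j lt /andP[hj]].
  have le_jt : j <= t by apply: max_t; rewrite /ok hj andbT.
  by rewrite -(modn_expn2 _ le_jt); apply: section_stage_mono.
have -> : 2 ^ s = 2 ^ (s - t) * 2 ^ t by rewrite -expnD subnK.
by rewrite -mulnA leq_mul2l h orbT.
Qed.

Lemma cnt_dead s : 2 * cnt (2 ^ s) (fun v => ~~ alive s v) <= 2 ^ s.
Proof.
have union : cnt (2 ^ s) (fun v => ~~ alive s v) <= ssum s (fun e => cnt (2 ^ s) (killed e s)).
  rewrite exchange_ssum; apply: leq_ssum => v _.
  case: (boolP (alive s v)) => //=; rewrite /alive -has_predC => /hasP[e].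
  rewrite mem_iota add0n /= negbK => lt k.
  by rewrite /ssum (bigD1 (Ordinal lt)) //= k.
(* Cleared of denominators: the first [N] tests kill a proportion of at most [(1 - 2 ^- N) / 2]. *)
have sum_le N : 2 ^ N.+1 * ssum N (fun e => cnt (2 ^ s) (killed e s)) + 2 ^ s <= 2 ^ N * 2 ^ s.
  elim: N => [|N IH]; first by rewrite /ssum big_ord0 muln0 add0n mul1n.
  rewrite /ssum big_ord_recr /=.
  have := cnt_killed N s; rewrite addn2; move: IH; rewrite /ssum.
  set a := \sum_(_ < _) _; set b := cnt _ _; rewrite !expnS; nia.
have := sum_le s; rewrite expnS.
move: union; set a := cnt _ _; set b := ssum _ _ => le_ab le.
have : 2 ^ s * (2 * b) <= 2 ^ s * 2 ^ s by nia.
by rewrite leq_pmul2l ?expn2_gt0 //; lia.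
Qed.

(** A genuine test obeys its measure bound and is never clipped, so whatever lies in its member
    [e + 2] is killed. *)
Lemma alive_ml_random (R : realType) Z : (forall s, alive s (restr Z s)) -> ml_random R Z.
Proof.
move=> HZ c test Zc; pose e := prog_num c.
have small s : cnt (2 ^ s) (section_stage e s) * 2 ^ (e + 2) <= 2 ^ s.
  rewrite -[X in _ <= X]mul1n -(dyadic_le R) div1r -lee_fin.
  apply: le_trans (test (e + 2)); apply: uniform_measure_ge => Y /bexnP[j lt h].
  have [p sp vp] := str_of_level (ltn_pmod (restr Y s) (expn2_gt0 j)).
  exists p; last by apply/(cylinderE Y (L := s)); rewrite ?sp // /starts sp vp.
  apply/halts_halt; exists s; rewrite restr_set0.
  by have -> : str_num p = restr Y s %% 2 ^ j + 2 ^ j - 1 by rewrite -vp -sp -str_numE subn1.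
have [p /halts_halt[s]] := Zc (e + 2) I.
rewrite restr_set0 => h /(cylinderE _ (leqnn _))/eqP.
rewrite modn_small ?restr_ltn // => ep.
(* [alive] at [t] looks at test numbers below [t]; the string [p] is seen once [t] reaches its
   halting stage and its length. *)
pose t := maxn e.+1 (maxn s (size p)).
have /ballnP/(_ e) := HZ t; rewrite {1}/t leq_maxl => /(_ isT)/negP; apply.
apply/bexnP; exists t => //; rewrite small modn_small ?restr_ltn //=.
have le_pt : size p <= t by rewrite /t !leq_max leqnn !orbT.
apply/bexnP; exists (size p) => //.
rewrite restr_modn // ep -str_numE subn1 /=; apply: halt_mono h => //.
by rewrite /t !leq_max leqnn orbT.
Qed.

(** * Low members of [Pi_1] classes *)

Definition njoin (s x y : nat) : nat :=
  ssum (2 * s) (fun i => (if odd i then bit y i./2 else bit x i./2) * 2 ^ i).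

Lemma njoin_restr s x y : njoin s x y = restr [set i | if odd i then bit y i./2 else bit x i./2] (2 * s).
Proof.
rewrite /restr /njoin; apply: eq_ssum => i _; congr (nat_of_bool _ * _).
by rewrite -[LHS]asboolb; congr asbool; rewrite /=; case: odd.
Qed.

Lemma njoin_ltn s x y : njoin s x y < 2 ^ (2 * s).
Proof. by rewrite njoin_restr restr_ltn. Qed.

Lemma bit_njoin s x y i :
  bit (njoin s x y) i = (i < 2 * s) && (if odd i then bit y i./2 else bit x i./2).
Proof.
rewrite njoin_restr bit_restr; by congr (_ && _); rewrite -[RHS]asboolb.
Qed.

Lemma njoin_modn s t x y : t <= s -> njoin s x y %% 2 ^ (2 * t) = njoin t (x %% 2 ^ t) (y %% 2 ^ t).
Proof.
move=> le; apply: (@bit_inj (2 * t)); [exact: ltn_pmod (expn2_gt0 _)|exact: njoin_ltn|].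
move=> i lt; rewrite bit_modn !bit_njoin lt !bit_modn.
have -> : i < 2 * s by lia.
by have -> : i./2 < t by lia.
Qed.

Lemma njoin_tjoin s X Y : njoin s (restr X s) (restr Y s) = restr (tjoin X Y) (2 * s).
Proof.
apply: (@bit_inj (2 * s)); [exact: njoin_ltn|exact: restr_ltn|].
move=> i lt; rewrite bit_njoin !bit_restr lt /= /tjoin /=.
have -> : i./2 < s by lia.
by rewrite !andTb; case: odd; rewrite ?lt.
Qed.

Lemma njoin_inj s x y x' y' : x < 2 ^ s -> y < 2 ^ s -> x' < 2 ^ s -> y' < 2 ^ s ->
  njoin s x y = njoin s x' y' -> x = x' /\ y = y'.
Proof.
move=> hx hy hx' hy' e; split; apply: (@bit_inj s) => // i lt.
  have := bit_njoin s x y i.*2; rewrite e bit_njoin odd_double doubleK.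
  by have -> : i.*2 < 2 * s by lia.
have := bit_njoin s x y i.*2.+1; rewrite e bit_njoin /= odd_double /= uphalf_double.
by have -> : i.*2.+1 < 2 * s by lia.
Qed.

(** Injectivity of the join gives one inequality; applied to [P] and to its complement, whose counts
    total [2 ^ (2 * s)] on either side, it gives equality. *)
Lemma cnt_njoin s (P : nat -> bool) :
  ssum (2 ^ s) (fun x => cnt (2 ^ s) (fun y => P (njoin s x y))) = cnt (2 ^ (2 * s)) P.
Proof.
have le Q : ssum (2 ^ s) (fun x => cnt (2 ^ s) (fun y => Q (njoin s x y))) <= cnt (2 ^ (2 * s)) Q.
  apply: (@leq_trans (cnt (2 ^ s * 2 ^ s) (fun v => Q (njoin s (v %/ 2 ^ s) (v %% 2 ^ s))))).
    rewrite [in X in _ <= X]/cnt ssum_mul; apply: leq_ssum => x _; apply: leq_ssum => y lt.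
    by rewrite addnC mulnC modnMDl divnMDl ?expn2_gt0 // divn_small ?modn_small // addn0.
  apply: (cnt_inj (f := fun v => njoin s (v %/ 2 ^ s) (v %% 2 ^ s))).
    by move=> v _ Qv; split=> //; apply: njoin_ltn.
  have lt v := ltn_pmod v (expn2_gt0 s).
  move=> u v hu hv _ _ /njoin_inj[]; rewrite ?lt ?ltn_divLR ?expn2_gt0 //.
  by move=> e1 e2; rewrite (divn_eq u (2 ^ s)) e1 e2 -divn_eq.
have e : ssum (2 ^ s) (fun x => cnt (2 ^ s) (fun y => P (njoin s x y))) +
         ssum (2 ^ s) (fun x => cnt (2 ^ s) (fun y => ~~ P (njoin s x y))) = 2 ^ (2 * s).
  rewrite /ssum -big_split /=.
  under eq_bigr do rewrite cntC.
  by rewrite sum_nat_const card_ord -expnD mul2n addnn.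
have := le P; have := le (fun v => ~~ P v); have := cntC (2 ^ (2 * s)) P.
rewrite -e; lia.
Qed.

Lemma ssum_exists N F c : 0 < N -> ssum N F <= N * c -> exists2 i, i < N & F i <= c.
Proof.
move=> N0 le; apply: contrapT => no.
have : ssum N (fun=> c.+1) <= ssum N F.
  by apply: leq_ssum => i lt; rewrite ltnNge; apply/negP => h; apply: no; exists i.
by rewrite ssum_const; nia.
Qed.

(* Stage by stage, [B] collects the [e] for which divergence at [e]
   can be forced inside the class, which is a [Pi_1] question; every member of the
   intersection then has jump the complement of [B]. *)
Lemma low_basis (D : nat -> nat -> bool) : recin2 set0 (fun s v => nat_of_bool (D s v)) ->
  (forall s t v, t <= s -> D s v -> D t (v %% 2 ^ t)) ->
  (forall s, exists2 v, v < 2 ^ s & D s v) ->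
  exists2 X, turing_le (jump X) (jump set0) & forall s, D s (restr X s).
Proof.
move=> HD down ex.
(* [b] codes the indices below [e] at which divergence is imposed; some string of length [s] in the
   class must not have halted at any of them. *)
pose FF b e s := bexn (2 ^ s) (fun x => D s x && balln e (fun i => bit b i ==> ~~ halt s x i i)).
pose G b e := `[< forall s, FF b e s >].
have HG : recin2 (jump set0) (fun b e => nat_of_bool (G b e)).
  have : recin2 set0 (fun p s => nat_of_bool (FF (nfst p) (nsnd p) s)) by rewrite /FF; solve_recin.
  exact: recin_pi1.
(* [G] is asked with digit [k] added, and the digit is kept exactly if this divergence is compatible
   with those imposed before. *)
pose beta e := nat_rect (fun=> nat) 0 (fun k r => r + G (r + 2 ^ k) k.+1 * 2 ^ k) e.
pose B := [set e | G (beta e + 2 ^ e) e.+1].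
have betaE e : beta e = restr B e.
  elim: e => [|e IH]; first by rewrite restr0.
  by rewrite restrS -IH /= /B /= asboolb.
have inv e : G (restr B e) e.
  elim: e => [|e /asboolP IH].
    apply/asboolP => s; have [v lt Dv] := ex s; apply/bexnP; exists v => //.
    by rewrite Dv.
  case: (pselect (B e)) => Be; first by rewrite restrS asboolT // mul1n -betaE.
  apply/asboolP => s; have /bexnP[x lt /andP[Dx /ballnP H]] := IH s.
  apply/bexnP; exists x; rewrite // Dx; apply/ballnP => i.
  rewrite restrS asboolF // mul0n addn0 ltnS leq_eqVlt => /orP[/eqP ->|/H //].
  by rewrite bit_restr ltnn.
(* Level [s] respects only the indices below [s], so that [inv s] supplies a string of it. *)
pose D' s x := D s x /\ forall i, i < s -> B i -> ~~ halt s x i i.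
have [s v _|s|X HX] := @koenig D'.
- move=> [h1 h2]; split=> [|i lt Bi]; first exact: down h1.
  apply: contra (h2 i (ltnW lt) Bi); apply: halt_mono => // j ltj.
  by rewrite bit_modn ltj.
- have /asboolP/(_ s)/bexnP[x lt /andP[Dx /ballnP H]] := inv s.
  exists x => //; split=> // i lti Bi.
  by move: (H i lti); rewrite bit_restr lti asboolT.
exists X; last by move=> s; have [] := HX s.
have jumpE e : jump X e <-> ~ B e.
  rewrite jump_halt; split=> [[s h] Be|nB].
    have [_ /(_ e)] := HX (maxn s e.+1); rewrite leq_maxr => /(_ isT Be)/negP; apply.
    apply: halt_mono h; first exact: leq_maxl.
    by move=> i lt; rewrite !bit_restr lt (leq_trans lt (leq_maxl _ _)).
  (* Imposing divergence at [e] empties some level [s], yet [restr X s] meets all the other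
     requirements there; so the computation at [e] halts. *)
  have : ~ forall s, FF (beta e + 2 ^ e) e.+1 s by move=> h; apply: nB; apply/asboolP.
  move=> /existsNP[s /negP/bexnP h].
  have [Ds _] := HX s; apply: contrapT => no; apply: h; exists (restr X s); first exact: restr_ltn.
  rewrite Ds; apply/ballnP => i; rewrite ltnS leq_eqVlt => /orP[/eqP ->|lt].
    by apply/implyP => _; apply/negP => h; apply: no; exists s.
  have -> : bit (beta e + 2 ^ e) i = bit (beta e) i.
    have -> : bit (beta e + 2 ^ e) i = bit ((beta e + 2 ^ e) %% 2 ^ e) i by rewrite bit_modn lt.
    by rewrite modnDr bit_modn lt.
  rewrite betaE bit_restr lt; apply/implyP => /asboolP Bi.
  have [_ /(_ i)] := HX (maxn s i.+1); rewrite leq_maxr => /(_ isT Bi).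
  apply: contra; apply: halt_mono; first exact: leq_maxl.
  by move=> j ltj; rewrite !bit_restr ltj (leq_trans ltj (leq_maxl _ _)).
apply/turing_le_recin.
apply: (@recin_ext _ (fun e => nat_of_bool (~~ G (beta e + 2 ^ e) e.+1))).
  move=> e; congr nat_of_bool.
  case: (pselect (B e)) => Be; first by rewrite asboolF ?[G _ _]Be // jumpE.
  by rewrite asboolT ?jumpE //; apply/negP.
have Hbeta : recin (jump set0) beta.
  apply: (recin_natrec (b := id) (f := fun=> 0) (G := fun _ k r => r + G (r + 2 ^ k) k.+1 * 2 ^ k)).
  - by solve_recin.
  - by solve_recin.
  - by solve_recin.
by solve_recin.
Qed.

Definition fat (s x : nat) : bool :=
  2 ^ s <= 2 * cnt (2 ^ s) (fun y => alive (2 * s) (njoin s x y)).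

Lemma exists_low_fat : exists2 X, turing_le (jump X) (jump set0) & forall s, fat s (restr X s).
Proof.
apply: low_basis.
- by rewrite /fat /alive /killed /section_stage /njoin; solve_recin.
- move=> s t x le; rewrite /fat => h.
  have : 2 ^ s <= 2 * (2 ^ (s - t) * cnt (2 ^ t) (fun y => alive (2 * t) (njoin t (x %% 2 ^ t) y))).
    apply: leq_trans h _; rewrite leq_mul2l /= -cnt_modn //; apply: leq_cnt => y _ h.
    by rewrite -(njoin_modn x y le); apply: alive_mono h; rewrite leq_mul2l.
  by rewrite -[in X in X <= _ -> _](subnK le) expnD mulnCA leq_mul2l expn_eq0.
(* Averaging: at most half of all pairs are dead, so some [x] has at most half of its [y] dead. *)
- move=> s; have [] := @ssum_exists (2 ^ s)
    (fun x => 2 * cnt (2 ^ s) (fun y => ~~ alive (2 * s) (njoin s x y))) (2 ^ s).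
  + exact: expn2_gt0.
  + rewrite /ssum -big_distrr /= -expnD addnn -mul2n; apply: leq_trans (cnt_dead (2 * s)).
    by rewrite -(cnt_njoin s (fun v => ~~ alive (2 * s) v)).
  + move=> x lt h; exists x => //; rewrite /fat.
    have := cntC (2 ^ s) (fun y => alive (2 * s) (njoin s x y)); lia.
Qed.

(** * Coding into a tree of positive measure *)

Lemma ssum_ltn N m : m <= N -> ssum N (fun i => i < m) = m.
Proof.
move=> le; rewrite -(subnKC le) ssumD (@eq_ssum _ _ (fun=> 1)); last by move=> i ->.
rewrite ssum_const muln1 (@eq_ssum _ _ (fun=> 0)) ?ssum_const ?muln0 ?addn0 // => i _.
by rewrite ltnNge leq_addr.
Qed.

Lemma cnt_gt1P N (P : nat -> bool) : 1 < cnt N P -> exists i j, [/\ i < j, j < N, P i & P j].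
Proof.
elim: N => [|N IH]; first by rewrite /cnt /ssum big_ord0.
rewrite /cnt /ssum big_ord_recr /= -/(ssum N (fun v => nat_of_bool (P v))) -/(cnt N P).
case E : (P N) => /=; last first.
  by rewrite addn0 => /IH[i [j [ij jN Pi Pj]]]; exists i, j; split=> //; apply: ltnW.
rewrite addn1 ltnS => /cnt_gt0P[i lt Pi].
by exists i, N; split.
Qed.

(** [least] and [greatest] count the numbers below the one sought, which makes them recursive as
    bounded sums. *)
Definition least (N : nat) (P : nat -> bool) : nat := ssum N (fun i => ~~ bexn i.+1 P).
Definition greatest (N : nat) (P : nat -> bool) : nat :=
  ssum N (fun i => bexn N (fun j => (i < j) && P j)).

Lemma leastP N (P : nat -> bool) : (exists2 i, i < N & P i) ->
  [/\ least N P < N, P (least N P) & forall i, i < least N P -> ~~ P i].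
Proof.
move=> [j ltj Pj]; have ex : exists j, P j by exists j.
case: (ex_minnP ex) => m Pm min_m.
have ltm : m < N by apply: leq_ltn_trans (min_m _ Pj) ltj.
have -> : least N P = m.
  rewrite -[RHS](ssum_ltn (ltnW ltm)) /least; apply: eq_ssum => i _; congr nat_of_bool.
  apply/idP/idP => [/bexnP no|lt]; last first.
    by apply/bexnP => -[k lek Pk]; have := min_m _ Pk; lia.
  by rewrite ltnNge; apply/negP => le; apply: no; exists m.
by split=> // i lt; apply/negP => /min_m; lia.
Qed.

Lemma greatestP N (P : nat -> bool) : (exists2 i, i < N & P i) ->
  [/\ greatest N P < N, P (greatest N P) & forall i, greatest N P < i -> i < N -> ~~ P i].
Proof.
move=> [j ltj Pj]; have ex : exists j, (j < N) && P j by exists j; rewrite ltj.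
have bd i : (i < N) && P i -> i <= N by case/andP => /ltnW.
case: (ex_maxnP ex bd) => m /andP[ltm Pm] max_m.
have -> : greatest N P = m.
  rewrite -[RHS](ssum_ltn (ltnW ltm)) /greatest; apply: eq_ssum => i _; congr nat_of_bool.
  apply/bexnP/idP => [[k lek /andP[ik Pk]]|lt]; last by exists m => //; rewrite lt.
  by apply: leq_trans ik _; apply: max_m; rewrite lek.
by split=> // i lt lti; apply/negP => Pi; have := max_m i; rewrite lti Pi => /(_ isT); lia.
Qed.

Lemma recin_least A f (P : nat -> nat -> bool) : recin A f ->
  recin2 A (fun n v => nat_of_bool (P n v)) -> recin A (fun n => least (f n) (P n)).
Proof. by move=> Hf HP; rewrite /least; solve_recin. Qed.

Lemma recin_greatest A f (P : nat -> nat -> bool) : recin A f ->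
  recin2 A (fun n v => nat_of_bool (P n v)) -> recin A (fun n => greatest (f n) (P n)).
Proof. by move=> Hf HP; rewrite /greatest; solve_recin. Qed.

Section Coding.
Variable al : nat -> nat -> bool.
Hypothesis al_down : forall s t v, t <= s -> al s v -> al t (v %% 2 ^ t).

(* At resolution [t], the proportion of the tree above the string [u] of length [l] is at
   least [2 ^- k]. *)
Definition dense_at (k l u t : nat) : bool :=
  2 ^ t <= 2 ^ k * cnt (2 ^ t) (fun y => al (l + t) (u + 2 ^ l * y)).

Definition dense (k l u : nat) : Prop := forall t, dense_at k l u t.

Lemma dense_at_mono k l u s t : u < 2 ^ l -> t <= s -> dense_at k l u s -> dense_at k l u t.
Proof.
move=> ltu le; rewrite /dense_at => h.
have : 2 ^ s <= 2 ^ k * (2 ^ (s - t) * cnt (2 ^ t) (fun y => al (l + t) (u + 2 ^ l * y))).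
  apply: leq_trans h _; rewrite leq_mul2l -cnt_modn // orbC; apply/orP; left.
  apply: leq_cnt => y _ h; have le' : l + t <= l + s by rewrite leq_add2l.
  have := al_down le' h; congr (al _ _).
  rewrite [in LHS](divn_eq y (2 ^ t)) mulnDr addnCA mulnCA -expnD modnMDl modn_small //.
  rewrite expnD; have := ltn_pmod y (expn2_gt0 t); set r := y %% _ => ltr.
  apply: (@leq_trans (2 ^ l * r.+1)); last by rewrite leq_mul2l ltr orbT.
  by rewrite mulnS ltn_add2r.
by rewrite -[in X in X <= _ -> _](subnK le) expnD mulnCA leq_mul2l expn_eq0.
Qed.

(** Of the [2 ^ (k + 2)] extensions, the [c] dense ones contribute at most [2 ^- (k + 2)] each and
    the others less than [2 ^- k.+1] in all. The total is at least [2 ^- k], hence [c] is at least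
    2. *)
Lemma dense_split k l u : u < 2 ^ l -> dense k l u ->
  exists j1 j2, [/\ j1 < j2, j2 < 2 ^ (k + 2),
    dense k.+1 (l + (k + 2)) (u + 2 ^ l * j1) & dense k.+1 (l + (k + 2)) (u + 2 ^ l * j2)].
Proof.
move=> ltu H; set m := k + 2.
have ltu' j : j < 2 ^ m -> u + 2 ^ l * j < 2 ^ (l + m).
  move=> ltj; rewrite expnD; apply: (@leq_trans (2 ^ l * j.+1)); last by rewrite leq_mul2l ltj orbT.
  by rewrite mulnS ltn_add2r.
have /choice[f Hf] : forall j, exists t, ~ dense k.+1 (l + m) (u + 2 ^ l * j) ->
    ~~ dense_at k.+1 (l + m) (u + 2 ^ l * j) t.
  move=> j; case: (pselect (dense k.+1 (l + m) (u + 2 ^ l * j))) => [d|/existsNP[t /negP nt]].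
    by exists 0.
  by exists t.
(* At this common resolution every extension that is not dense has already failed. *)
pose T := \max_(j < 2 ^ m) f j.
have HT j : j < 2 ^ m -> dense_at k.+1 (l + m) (u + 2 ^ l * j) T ->
    dense k.+1 (l + m) (u + 2 ^ l * j).
  move=> lt d; apply: contrapT => /Hf/negP; apply; apply: dense_at_mono d; first exact: ltu'.
  exact: (leq_bigmax (Ordinal lt)).
have : 1 < cnt (2 ^ m) (fun j => dense_at k.+1 (l + m) (u + 2 ^ l * j) T); last first.
  move=> /cnt_gt1P[i [j [ij ltj di dj]]]; exists i, j; split=> //; apply: HT => //.
  exact: ltn_trans ltj.
set c := cnt _ _.
pose g j := cnt (2 ^ T) (fun y => al (l + m + T) (u + 2 ^ l * j + 2 ^ (l + m) * y)).
have le_tot : 2 ^ (m + T) <= 2 ^ k * ssum (2 ^ m) g.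
  apply: leq_trans (H (m + T)) _; rewrite leq_mul2l expnD /cnt ssum_mul exchange_ssum.
  apply/orP; right; apply: leq_ssum => j _; apply: leq_ssum => y _.
  by rewrite mulnDr mulnA -expnD !addnA.
have le_g j : 2 ^ k.+1 * g j <=
    2 ^ k.+1 * 2 ^ T * dense_at k.+1 (l + m) (u + 2 ^ l * j) T + 2 ^ T.
  case: (boolP (dense_at _ _ _ _)) => [_|]; last first.
    by rewrite /dense_at -ltnNge muln0 add0n => /ltnW.
  by rewrite muln1; apply: leq_trans (leq_addr _ _); rewrite leq_mul2l cnt_leq orbT.
have le_c : 2 ^ k.+1 * ssum (2 ^ m) g <= 2 ^ k.+1 * 2 ^ T * c + 2 ^ m * 2 ^ T.
  rewrite -[2 ^ m * 2 ^ T]ssum_const /c /cnt /ssum !big_distrr /= -big_split /=.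
  by apply: leq_sum => j _; apply: le_g.
have em : 2 ^ m = 2 * 2 ^ k.+1 by rewrite /m addn2 !expnS.
have := expn2_gt0 T; have := expn2_gt0 k.
move: le_c le_tot; rewrite expnD em expnS.
set a := ssum _ _; set K := 2 ^ k; set V := 2 ^ T => h1 h2 K0 V0.
have h3 : 4 * (2 * K * V) <= 2 * K * V * (c + 2) by nia.
have : 4 <= c + 2 by rewrite mulnC leq_pmul2l // in h3; nia.
lia.
Qed.

End Coding.

(** Density starts at 1/2 and is halved by each block, so block [n] applies [dense_split] with
    [k = n.+1] and takes [n + 3] letters. *)
Definition code_len (n : nat) : nat := ssum n (fun i => i + 3).

Lemma code_lenS n : code_len n.+1 = code_len n + (n.+1 + 2).
Proof. by rewrite /code_len /ssum big_ord_recr /= addSn addnS. Qed.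

Lemma code_len_ge n : n <= code_len n.
Proof. by elim: n => // n IH; rewrite code_lenS; lia. Qed.

Lemma code_len_mono m n : m <= n -> code_len m <= code_len n.
Proof. by move/subnK <-; elim: (n - m) => // d IH; rewrite addSn code_lenS; lia. Qed.

(* Kucera's coding: [A n] tells whether the least or the greatest dense extension is taken. *)
Lemma kucera_coding (X A : set nat) (al : nat -> nat -> bool) :
  recin2 X (fun s v => nat_of_bool (al s v)) ->
  (forall s t v, t <= s -> al s v -> al t (v %% 2 ^ t)) ->
  (forall s, 2 ^ s <= 2 * cnt (2 ^ s) (al s)) ->
  turing_le (jump X) A ->
  exists Y, [/\ forall s, al s (restr Y s), turing_le Y A &
    forall B, turing_le X B -> turing_le Y B -> turing_le A B].
Proof.
move=> Hal al_down al_half XA.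
pose ok n u j := `[< dense al n.+2 (code_len n.+1) (u + 2 ^ code_len n * j) >].
pose next n u := if `[< A n >] then greatest (2 ^ (n + 3)) (ok n u)
  else least (2 ^ (n + 3)) (ok n u).
pose code n := nat_rect (fun=> nat) 0 (fun n u => u + 2 ^ code_len n * next n u) n.
have split n u : u < 2 ^ code_len n -> dense al n.+1 (code_len n) u ->
    exists j1 j2, [/\ j1 < j2, j2 < 2 ^ (n + 3), ok n u j1 & ok n u j2].
  move=> ltu /(dense_split al_down ltu)[j1 [j2 [lt ltj d1 d2]]].
  by exists j1, j2; rewrite -[n + 3]addSnnS; split=> //; apply/asboolP; rewrite code_lenS.
have nextP n u : u < 2 ^ code_len n -> dense al n.+1 (code_len n) u ->
    [/\ next n u < 2 ^ (n + 3), ok n u (next n u),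
      A n -> (exists2 j, j < next n u & ok n u j) /\
             (forall j, next n u < j -> j < 2 ^ (n + 3) -> ~~ ok n u j) &
      ~ A n -> (exists j, [/\ next n u < j, j < 2 ^ (n + 3) & ok n u j]) /\
             (forall j, j < next n u -> ~~ ok n u j)].
  move=> ltu /(split _ _ ltu)[j1 [j2 [lt12 lt2 ok1 ok2]]].
  rewrite /next; case: asboolP => An.
    have [|lt okg max_g] := @greatestP (2 ^ (n + 3)) (ok n u); first by exists j2.
    split=> // _; split=> //; exists j1 => //; apply: leq_trans lt12 _.
    by rewrite leqNgt; apply/negP => /max_g /(_ lt2)/negP.
  have [|lt okg min_g] := @leastP (2 ^ (n + 3)) (ok n u); first by exists j2.
  split=> // _; split=> //; exists j2; split=> //; apply: leq_ltn_trans lt12.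
  by rewrite leqNgt; apply/negP => /min_g /negP.
have inv n : code n < 2 ^ code_len n /\ dense al n.+1 (code_len n) (code n).
  elim: n => [|n [lt d]].
    rewrite /code_len /ssum big_ord0; split=> // t; rewrite /dense_at.
    by apply: leq_trans (al_half t) _; rewrite leq_mul2l; apply: leq_cnt => y _; rewrite mul1n.
  have [ltn /asboolP okn _ _] := nextP n _ lt d; split=> //=.
  rewrite code_lenS addSnnS expnD; apply: (@leq_trans (2 ^ code_len n * (next n (code n)).+1)).
    by rewrite mulnS ltn_add2r.
  by rewrite leq_mul2l ltn orbT.
have code_modn m n : m <= n -> code n %% 2 ^ code_len m = code m.
  move=> /subnKC <-; elim: (n - m) => [|d IH].
    by rewrite addn0 modn_small //; have [] := inv m.
  have e : 2 ^ code_len (m + d) = 2 ^ code_len m * 2 ^ (code_len (m + d) - code_len m).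
    by rewrite -expnD subnKC // code_len_mono ?leq_addr.
  by rewrite addnS /= e -mulnA -modnDmr modnMr addn0.
(* [code i.+1] has at least [i.+1] digits, so its digit [i] is final. *)
pose Y := [set i | bit (code i.+1) i].
have resY n : restr Y (code_len n) = code n.
  apply: (@bit_inj (code_len n)); first exact: restr_ltn; first by have [] := inv n.
  move=> i lt; rewrite bit_restr lt /= asboolb.
  have := bit_modn (code (maxn n i.+1)) (code_len n) i.
  have := bit_modn (code (maxn n i.+1)) (code_len i.+1) i.
  by rewrite !code_modn ?leq_maxl ?leq_maxr // lt code_len_ge => -> ->.
have Hdense D fk fl fu ft : recin2 D (fun s v => nat_of_bool (al s v)) -> recin D fk -> recin D fl ->
    recin D fu -> recin D ft ->
    recin D (fun n => nat_of_bool (dense_at al (fk n) (fl n) (fu n) (ft n))).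
  by move=> HD *; rewrite /dense_at; solve_recin.
have Hlen D f : recin D f -> recin D (fun n => code_len (f n)).
  by move=> Hf; rewrite /code_len; solve_recin.
exists Y; split.
(* At resolution 0, density says that the coded string itself is in the tree. *)
- move=> s; have [_ /(_ 0)] := inv s; rewrite /dense_at expn0 addn0.
  case E : (al (code_len s) (code s)).
    by move=> _; rewrite -(restr_modn Y (code_len_ge s)) resY; apply: al_down E; apply: code_len_ge.
  rewrite /cnt /ssum big_ord_recl big_ord0 /= muln0 addn0.
  by rewrite addn0 E muln0.
(* Density is a Pi_1 question relative to [X], which [A] answers through the jump of [X]. *)
- have Hok f g h : recin A f -> recin A g -> recin A h ->
      recin A (fun n => nat_of_bool (ok (f n) (g n) (h n))).
    apply: (recin_app3 (F := fun n u j => nat_of_bool (ok n u j))).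
    apply: recin_trans XA _.
    apply: (recin_pi1 (R := fun p => dense_at al (nfst p).+2 (code_len (nfst p).+1)
      (nfst (nsnd p) + 2 ^ code_len (nfst p) * nsnd (nsnd p)))).
    apply: Hdense => //; solve_recin.
    + by apply: Hlen; solve_recin.
    + by apply: Hlen; solve_recin.
  have Hcode : recin A code.
    apply: (recin_natrec (b := id) (f := fun=> 0) (G := fun _ n u => u + 2 ^ code_len n * next n u)).
    + by solve_recin.
    + by solve_recin.
    + solve_recin; first by apply: Hlen; solve_recin.
        by apply: recin_greatest; [solve_recin|apply: Hok; solve_recin].
      by apply: recin_least; [solve_recin|apply: Hok; solve_recin].
  apply/turing_le_recin; apply: (@recin_ext _ (fun n => nat_of_bool (bit (code n.+1) n))).
    by move=> n; rewrite asboolb.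
  by solve_recin.
move=> B XB YB.
have HalB : recin2 B (fun s v => nat_of_bool (al s v)) by apply: recin_trans XB Hal.
have HresB : recin B (restr Y) by exact: recin_trans YB (recin_restr (recin_id Y)).
pose u n := restr Y (code_len n); pose J n := u n.+1 %/ 2 ^ code_len n.
have eu n : u n = code n by exact: resY.
have eJ n : J n = next n (code n).
  have [lt _] := inv n.
  by rewrite /J eu /= addnC mulnC divnMDl ?expn2_gt0 // divn_small ?addn0.
pose D n j t := dense_at al n.+2 (code_len n.+1) (u n + 2 ^ code_len n * j) t.
(* Everything left of the chosen extension has failed by resolution [t], or else, in [right],
   everything right of it. The second dense extension makes [left] impossible if [A n] holds and
   [right] impossible if not. *)
pose left n t := balln (J n) (fun j => ~~ D n j t).
pose right n t := balln (2 ^ (n + 3)) (fun j => (J n < j) ==> ~~ D n j t).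
have D_mono n j s t : j < 2 ^ (n + 3) -> t <= s -> D n j s -> D n j t.
  move=> ltj le; rewrite /D; apply: (dense_at_mono al_down) => //; rewrite code_lenS addSnnS expnD eu.
  have [lt _] := inv n; apply: (@leq_trans (2 ^ code_len n * j.+1)).
    by rewrite mulnS ltn_add2r.
  by rewrite leq_mul2l ltj orbT.
have okD n j : ok n (code n) j <-> forall t, D n j t.
  by rewrite /D eu; split=> [/asboolP|H]; [|apply/asboolP].
(* Finitely many extensions without density fail at a common resolution. *)
have die n (S : nat -> bool) : (forall j, j < 2 ^ (n + 3) -> S j -> ~~ ok n (code n) j) ->
    exists t, forall j, j < 2 ^ (n + 3) -> S j -> ~~ D n j t.
  move=> H; have /choice[f Hf] : forall j, exists t, j < 2 ^ (n + 3) -> S j -> ~~ D n j t.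
    move=> j; case: (pselect (exists t, ~~ D n j t)) => [[t nD]|no]; first by exists t.
    exists 0 => lt Sj; have /negP := H j lt Sj; case; apply/okD => t.
    by apply/negPn/negP => nD; apply: no; exists t.
  exists (\max_(j < 2 ^ (n + 3)) f j) => j lt Sj; apply: contra (Hf j lt Sj).
  by apply: D_mono => //; apply: (leq_bigmax (Ordinal lt)).
have leftF n : A n -> forall t, ~~ left n t.
  move=> An t; have [lt d] := inv n; have [ltn _ /(_ An)[[j ltj okj] _] _] := nextP n _ lt d.
  by apply/negP => /ballnP/(_ j); rewrite eJ => /(_ ltj)/negP; apply; exact: (proj1 (okD n j) okj).
have rightF n : ~ A n -> forall t, ~~ right n t.
  move=> An t; have [lt d] := inv n; have [ltn _ _ /(_ An)[[j [ltj ltj' okj]] _]] := nextP n _ lt d.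
  by apply/negP => /ballnP/(_ j ltj'); rewrite eJ ltj => /negP; apply; exact: (proj1 (okD n j) okj).
have ex n : exists t, left n t || right n t.
  have [lt d] := inv n; have [ltn _ HA HnA] := nextP n _ lt d.
  case: (pselect (A n)) => An.
    have [j ltj|t Ht] := @die n (fun j => J n < j).
      by rewrite eJ => lt'; have [_] := HA An; apply.
    by exists t; apply/orP; right; apply/ballnP => j ltj; apply/implyP; apply: Ht.
  have [j _|t Ht] := @die n (fun j => j < J n).
    by rewrite eJ => lt'; have [_] := HnA An; apply.
  exists t; apply/orP; left; apply/ballnP => j ltj; apply: Ht => //.
  by move: ltj; rewrite eJ => ltj; apply: ltn_trans ltn.
have Hu f : recin B f -> recin B (fun n => u (f n)).
  by move=> Hf; rewrite /u; solve_recin; apply: Hlen; solve_recin.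
have HJ f : recin B f -> recin B (fun n => J (f n)).
  by move=> Hf; rewrite /J; solve_recin; [apply: Hu; solve_recin|apply: Hlen; solve_recin].
have HD f g h : recin B f -> recin B g -> recin B h ->
    recin B (fun n => nat_of_bool (D (f n) (g n) (h n))).
  move=> *; rewrite /D; apply: Hdense => //; solve_recin; try (by apply: Hlen; solve_recin).
  by apply: Hu; solve_recin.
have Hleft : recin2 B (fun n t => nat_of_bool (left n t)).
  by rewrite /left; solve_recin; [apply: HJ; solve_recin|apply: HD; solve_recin].
have Hright : recin2 B (fun n t => nat_of_bool (right n t)).
  by rewrite /right; solve_recin; [apply: HJ; solve_recin|apply: HD; solve_recin].
have Hex : recin B (fun n => ex_minn (ex n)).
  by apply: recin_search; solve_recin.
apply/turing_le_recin; apply: (@recin_ext _ (fun n => nat_of_bool (~~ left n (ex_minn (ex n))))).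
  move=> n; congr nat_of_bool; case: ex_minnP => t lr _.
  case: (pselect (A n)) => An; first by rewrite asboolT // leftF.
  by rewrite asboolF //; move: lr; rewrite (negbTE (rightF n An t)) orbF => ->.
by solve_recin.
Qed.

(** * Incompleteness, and the halting problem from Omega *)

Lemma str_num_level p l u : u < 2 ^ l -> (str_num p).+1 = u + 2 ^ l -> size p = l /\ str_val p = u.
Proof.
move=> lt; have [q <- <-] := str_of_level lt; rewrite -str_numE => -[/str_num_inj ->].
by [].
Qed.

(* If [X] is computed from [Y], then [X (+) Y] lies in every one of the sets of all [X (+) Y]
   with [X] and [Phi ^ Y] agreeing below [n], which form a test. *)
Lemma computed_half_not_random (R : realType) X Y : turing_le X Y -> ~ ml_random R (tjoin X Y).
Proof.
move=> [d Hd]; pose e := prog_num d.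
pose agr n L x y := (n <= L) && balln n (fun i => eval_stage L y e i (bit x i)).
have agr_mono n L L' x y x' y' : L <= L' -> x' %% 2 ^ L = x -> y' %% 2 ^ L = y ->
    agr n L x y -> agr n L' x' y'.
  move=> le ex ey /andP[leL /ballnP H]; apply/andP; split; first exact: leq_trans le.
  apply/ballnP => i lt; have ltL := leq_trans lt leL.
  have := H i lt; rewrite -ex bit_modn ltL; apply: eval_stage_mono => // j ltj.
  by rewrite -ey bit_modn ltj.
(* The witness [t] codes [L], [x] and [y]; the enumerated string is the join of [x] and [y], of
   length [2 * L]. *)
pose P m t := [&& nfst (nsnd t) < 2 ^ nfst t, nsnd (nsnd t) < 2 ^ nfst t,
  (nsnd m).+1 == njoin (nfst t) (nfst (nsnd t)) (nsnd (nsnd t)) + 2 ^ (2 * nfst t) &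
  agr (nfst m) (nfst t) (nfst (nsnd t)) (nsnd (nsnd t))].
have /sigma1_halts[c Hc] : recin2 set0 (fun m t => nat_of_bool (P m t)).
  by rewrite /P /agr /njoin; solve_recin.
have cE n p : ce_section c n p <-> exists L x y,
    [/\ x < 2 ^ L, y < 2 ^ L, size p = 2 * L, str_val p = njoin L x y & agr n L x y].
  rewrite /ce_section /= Hc /P !(nfst_npair, nsnd_npair).
  split=> [[t /and4P[hx hy /eqP/(str_num_level (njoin_ltn _ _ _))[ep vp] h]]|].
    by exists (nfst t), (nfst (nsnd t)), (nsnd (nsnd t)).
  move=> [L [x [y [hx hy ep vp h]]]]; exists (npair L (npair x y)).
  by rewrite !(nfst_npair, nsnd_npair) hx hy h andbT str_numE ep vp eqxx.
move=> /(_ c); apply.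
  move=> n; apply: uniform_measure_le => L.
  have -> : (2 ^- n = 1%:R / 2 ^+ n :> R)%R by rewrite div1r.
  rewrite lee_fin dyadic_le mul1n.
  have covE x y : x < 2 ^ L -> y < 2 ^ L -> covered (ce_section c n) L (njoin L x y %% 2 ^ L) ->
      agr n L x y.
    move=> hx hy /asboolP[p /cE[L' [x' [y' [hx' hy' ep vp h]]]] /andP[lep]].
    rewrite starts_modn // /starts ep vp; have leL : L' <= L by lia.
    rewrite njoin_modn // => /eqP/njoin_inj[]; rewrite ?ltn_pmod ?expn2_gt0 // => ex ey.
    exact: agr_mono h.
  case: (leqP n L) => [le_nL|lt]; last first.
    rewrite (_ : cnt _ _ = 0) //; apply/eqP; rewrite -leqn0 leqNgt; apply/negP.
    move=> /cnt_gt0P[v ltv /asboolP[p /cE[L' [x' [y' [_ _ ep _ /andP[leL _]]]]] /andP[lep _]]].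
    lia.
  (* Evaluation is single-valued, so [f y] is the only possible beginning of an [x] that agrees with
     [y]. *)
  pose f y := restr [set i | eval_stage L y e i 1] n.
  have agr_f x y : agr n L x y -> x %% 2 ^ n == f y.
    move=> /andP[_ /ballnP H]; apply/eqP; apply: (@bit_inj n).
    - exact: ltn_pmod (expn2_gt0 _).
    - exact: restr_ltn.
    move=> i lt; rewrite bit_modn bit_restr lt /= asboolb.
    have := H i lt; case: (bit x i) => //= h; apply/esym/negP => h'.
    have ag : agree L y [set i | bit y i] by move=> j _; rewrite asboolb.
    by have := prog_eval_det (eval_stage_sound ag h) (eval_stage_sound ag h').
  (* Counted at length [2 * L], over joins of pairs: each [y] leaves [2 ^ (L - n)] strings [x]
     beginning with [f y]. *)
  have le1 : cnt (2 ^ L) (covered (ce_section c n) L) * 2 ^ L <= 2 ^ L * 2 ^ (L - n).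
    have -> : cnt (2 ^ L) (covered (ce_section c n) L) * 2 ^ L =
        cnt (2 ^ (2 * L)) (fun v => covered (ce_section c n) L (v %% 2 ^ L)).
      rewrite (cnt_modn (s := L)); last by lia.
      by rewrite mulnC; congr (2 ^ _ * _); lia.
    rewrite -cnt_njoin.
    apply: (@leq_trans (ssum (2 ^ L) (fun x => cnt (2 ^ L) (fun y => x %% 2 ^ n == f y)))).
      by apply: leq_ssum => x hx; apply: leq_cnt => y hy h; apply/agr_f/covE.
    rewrite exchange_ssum -ssum_const; apply: leq_ssum => y _.
    rewrite -/(cnt (2 ^ L) (fun x => x %% 2 ^ n == f y)).
    by rewrite (cnt_modn (fun v => v == f y) le_nL) cnt_pred1 ?muln1 // restr_ltn.
  have : 2 ^ L = 2 ^ (L - n) * 2 ^ n by rewrite -expnD subnK.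
  move: le1 (expn2_gt0 L); rewrite mulnC leq_pmul2l ?expn2_gt0 // => le1 _ e2.
  by rewrite [X in _ <= X]e2 leq_mul2r le1 orbT.
move=> n _.
have [m Hm] : exists m, forall L, m <= L -> forall i, i < n -> eval_stage L (restr Y L) e i `[<X i>].
  elim: n => [|n [m IH]]; first by exists 0.
  have [m' Hm'] := eval_stage_complete (Hd n); exists (maxn m m') => L.
  rewrite geq_max => /andP[le le'] i; rewrite ltnS leq_eqVlt => /orP[/eqP ->|]; last exact: IH.
  by apply: Hm' => //; apply: agree_restr.
pose L := maxn n m.
have [p sp vp] := str_of_level (restr_ltn (tjoin X Y) (2 * L)).
exists p; last by apply/(cylinderE _ (leqnn _)); rewrite /starts sp vp modn_small ?restr_ltn.
apply/cE; exists L, (restr X L), (restr Y L); split; rewrite ?restr_ltn ?vp ?njoin_tjoin //.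
rewrite /agr leq_maxl; apply/ballnP => i lt.
by rewrite bit_restr (leq_trans lt (leq_maxl _ _)); apply: Hm; rewrite ?leq_maxr.
Qed.

(** * Approximation of the halting probability from below *)

Section HaltingProbability.
Variables (R : realType) (U : prog).
Hypothesis pfU : prefix_free U.
Local Notation Om := (halting_probability R U).
Local Open Scope ring_scope.

(** Kraft's inequality bounds the sum by 1, so [fine] does not return its default value. *)
Lemma halting_esum : (\esum_(p in machine_dom U) (2 ^- size p)%:E = Om%:E)%E.
Proof.
rewrite /halting_probability fineK // ge0_fin_numE; last first.
  by apply: esum_ge0 => p _; rewrite lee_fin invr_ge0 exprn_ge0 // ler0n.
apply: (@le_lt_trans _ _ 1%E); last by rewrite ltry.
apply: esum_weight_le => L F uF domF leF.
rewrite lee_fin ler_pdivrMr ?exprn_gt0 ?ltr0n // mul1r -natrX ler_nat.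
apply: leq_trans (weight_le_cnt leF uF _) (cnt_leq _ _).
by move=> p q /domF Up /domF; apply: pfU.
Qed.

Lemma weight_le_halting L F : uniq F -> {in F, forall p, machine_dom U p} ->
  {in F, forall p, (size p <= L)%N} -> (weight L F)%:R / 2 ^+ L <= Om.
Proof. by move=> *; rewrite -lee_fin -halting_esum esum_weight_ge. Qed.

Lemma halting_approx eps : 0 < eps -> exists L F,
  [/\ uniq F, {in F, forall p, machine_dom U p}, {in F, forall p, (size p <= L)%N} &
    Om - eps < (weight L F)%:R / 2 ^+ L].
Proof.
move=> eps0; apply: contrapT => no.
have : ((\esum_(p in machine_dom U) (2 ^- size p)%:E)%E <= (Om - eps)%:E)%E.
  apply: esum_weight_le => L F uF domF leF; rewrite lee_fin leNgt; apply/negP => lt.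
  by apply: no; exists L, F.
by rewrite halting_esum lee_fin lerBrDl gerDr leNgt eps0.
Qed.

Lemma halting_probability_ge0 : 0 <= Om.
Proof.
have := @weight_le_halting 0 [::] isT; rewrite /weight big_nil mul0r; apply.
  by move=> p; rewrite in_nil.
by move=> p; rewrite in_nil.
Qed.

End HaltingProbability.

Definition halted (U : prog) (t : nat) (p : seq bool) : bool :=
  (size p < t) && halt t 0 (prog_num U) (str_num p).

(* [2 ^ t] times the measure of the strings that are prefixed by some [p] with
   [halted U t p]. *)
Definition halted_measure (u t : nat) : nat :=
  cnt (2 ^ t) (fun v => bexn t (fun j => halt t 0 u (v %% 2 ^ j + 2 ^ j - 1))).

Lemma halted_dom U t p : halted U t p -> machine_dom U p.
Proof.
move=> /andP[_ h].
have /halts_halt[y Hy] : exists s, halt s (restr set0 s) (prog_num U) (str_num p).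
  by exists t; rewrite restr_set0.
by have [s es] := str_num_surj y; exists s; rewrite /machine es.
Qed.

Lemma halted_measureE U t : prefix_free U -> exists F,
  [/\ uniq F, forall p, (p \in F) = halted U t p & weight t F = halted_measure (prog_num U) t].
Proof.
move=> pfU; have /choice[str strK] := str_num_surj.
have numK : cancel str_num str by move=> p; apply: str_num_inj.
pose F := [seq p <- map str (iota 0 (2 ^ t)) | halted U t p].
have uF : uniq F.
  by rewrite filter_uniq // map_inj_uniq ?iota_uniq // => i j /(congr1 str_num); rewrite !strK.
have FE (p : seq bool) : (p \in F) = halted U t p.
  rewrite mem_filter andb_idr // => /andP[lt _]; rewrite -(numK p) map_f // mem_iota add0n /=.
  have := str_numE p; have := str_val_ltn p; have : 2 ^ (size p).+1 <= 2 ^ t by rewrite leq_exp2l.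
  by rewrite expnS; lia.
have leF : {in F, forall p, size p <= t} by move=> p; rewrite FE => /andP[/ltnW].
have domF p : p \in F -> machine_dom U p by rewrite FE => /halted_dom.
exists F; split=> //; apply/eqP.
have -> : halted_measure (prog_num U) t = cnt (2 ^ t) (fun v => has (starts^~ v) F).
  apply: eq_cnt => v _; apply/bexnP/hasP => [[j lt h]|[p]].
    have [p sp vp] := str_of_level (ltn_pmod v (expn2_gt0 j)).
    exists p; last by rewrite /starts sp vp.
    rewrite FE /halted sp lt; move: h.
    by have -> : v %% 2 ^ j + 2 ^ j - 1 = str_num p by rewrite -vp -sp -str_numE subn1.
  rewrite FE => /andP[lt h] /eqP st; exists (size p) => //.
  by rewrite st -str_numE subn1.
rewrite eqn_leq cnt_le_weight // andbT weight_le_cnt // => p q /domF Up /domF.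
exact: pfU.
Qed.

(** Doubling appends one binary digit; by this recurrence the set of digits gives back the dyadic
    approximations of the real. *)
Lemma truncn_double (R : realType) (y : R) : (0 <= y)%R ->
  Num.truncn (2 * y)%R = 2 * Num.truncn y + odd (Num.truncn (2 * y)%R).
Proof.
move=> y0; have /andP[h1 h2] := truncn_itv y0.
set k := Num.truncn y in h1 h2 *.
have e : ((2 * k)%N%:R = 2 * k%:R :> R)%R by rewrite natrM.
have h3 : ((2 * k)%N%:R <= 2 * y)%R by rewrite e ler_pM2l.
have h4 : (2 * y < (2 * k).+2%:R)%R.
  have -> : ((2 * k).+2%:R = 2 * k.+1%:R :> R)%R by rewrite -natrM; congr (_%:R)%R; lia.
  by rewrite ltr_pM2l.
case: (ltP (2 * y)%R (2 * k).+1%:R%R) => h.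
  have -> : Num.truncn (2 * y)%R = 2 * k by apply: truncn_def; rewrite h3.
  by rewrite oddM addn0.
have -> : Num.truncn (2 * y)%R = (2 * k).+1 by apply: truncn_def; rewrite h.
by rewrite /= oddM /= addn1.
Qed.

Definition unary_code (e : nat) : seq bool := rcons (nseq e true) false.

(** The value [2 ^ e - 1] and the length [e.+1] give this number; it makes the code recognizable by
    arithmetic. *)
Lemma str_num_unary_code e : str_num (unary_code e) = 3 * 2 ^ e - 2.
Proof.
elim: e => // e IH; rewrite /= IH expnS.
by have := expn2_gt0 e; lia.
Qed.

Lemma size_unary_code e : size (unary_code e) = e.+1.
Proof. by rewrite size_rcons size_nseq. Qed.

Lemma prefix_unary_code e e' : prefix (unary_code e) (unary_code e') -> e = e'.
Proof.
elim: e e' => [|e IH] [|e'] //=.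
by move=> /IH ->.
Qed.

(* Let [M] map the unary code of [e] to a bound on the halting time of [e].  Once all
   programs of [U] of length at most [e + d + 1] have halted, all these bounds have been
   output, and [Omega] tells when this is the case. *)
Theorem jump_le_Omega (R : realType) (U : prog) : universal_prefix_free U ->
  turing_le (jump set0) (Omega R U).
Proof.
move=> [pfU univ].
(* The output [t] is the pair of [e] and a halting stage, hence at least that stage. *)
pose P k t := (k == 3 * 2 ^ nfst t - 2) && halt (nsnd t) 0 (nfst t) (nfst t).
have [M HM] : exists M, forall n y, prog_eval set0 M n y <-> P n y /\ forall k, k < y -> ~~ P n k.
  by apply: sigma1_program; rewrite /P; solve_recin.
have domM p : machine_dom M p -> exists e, p = unary_code e.
  move=> [s /HM[/andP[/eqP ep _] _]]; exists (nfst (str_num s)).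
  by apply: str_num_inj; rewrite str_num_unary_code.
have pfM : prefix_free M.
  by move=> p q /domM[e ->] /domM[e' ->] /prefix_unary_code ->.
have [d Hd] := univ M pfM.
pose Om : R := halting_probability R U; pose u := prog_num U.
have Om0 : (0 <= Om)%R by exact: halting_probability_ge0.
pose digits n := Num.truncn (2 ^+ n * Om)%R.
have recOm : recin (Omega R U) digits.
  (* The integer part [digits 0] is not among the digits of the oracle and is hard-wired. *)
  apply: (@recin_ext _ (fun n => nat_rect (fun=> nat) (digits 0)
      (fun k r => 2 * r + `[<Omega R U k>]) n)).
    elim=> //= n ->; rewrite /digits exprS -mulrA truncn_double; last first.
      by rewrite mulr_ge0 // exprn_ge0.
    by rewrite mulrA -exprS /Omega /binary_expansion /= asboolb.
  apply: (recin_natrec (b := id) (f := fun=> digits 0)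
    (G := fun _ k r => 2 * r + `[<Omega R U k>])).
  - by solve_recin.
  - by solve_recin.
  - by solve_recin.
(* Cleared of denominators: the measure halted by stage [t] exceeds the [n]-digit truncation of
   [Omega] minus [2 ^- n]. *)
pose close n t := digits n * 2 ^ t < 2 ^ n * halted_measure u t + 2 ^ t.
have pow0 n : (0 < 2 ^+ n :> R)%R by rewrite exprn_gt0 // ltr0n.
have closeE n t : close n t =
    ((digits n)%:R / 2 ^+ n < (halted_measure u t)%:R / 2 ^+ t + 2 ^- n :> R)%R.
  rewrite ltr_pdivrMr // mulrDl mulVf ?gt_eqF // -(ltr_pM2r (pow0 t)) [in RHS]mulrDl mul1r.
  rewrite [(_ / 2 ^+ t * _)%R]mulrAC divfK ?gt_eqF // -!natrX -!natrM -natrD ltr_nat.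
  by rewrite /close [2 ^ n * _]mulnC.
have ex_close n : exists t, close n t.
  have eps0 : (0 < 2 ^- n :> R)%R by rewrite invr_gt0.
  have [L [F [uF domF leF lt]]] := halting_approx pfU eps0.
  have [t [ltLt Ht]] : exists t, L < t /\ {in F, forall p, halted U t p}.
    elim: F domF leF {uF lt} => [|p F IH] domF leF; first by exists L.+1.
    have [||t [ltLt Ht]] := IH.
    - by move=> q Fq; apply: domF; rewrite inE Fq orbT.
    - by move=> q Fq; apply: leF; rewrite inE Fq orbT.
    have [s Hs] := domF p (mem_head _ _).
    have /halts_halt[m] : halts set0 U (str_num p) by exists (str_num s).
    rewrite restr_set0 => hm; exists (maxn t m); split; first by rewrite leq_max ltLt.
    have mono q s1 s2 : s1 <= s2 -> halt s1 0 u q -> halt s2 0 u q by move=> *; apply: halt_mono; eauto.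
    move=> q; rewrite inE => /orP[/eqP ->|/Ht /andP[lq hq]]; apply/andP; split.
    - apply: leq_ltn_trans (leF p (mem_head _ _)) _; by rewrite leq_max ltLt.
    - by apply: mono hm; rewrite leq_maxr.
    - by rewrite leq_max lq.
    - by apply: mono hq; rewrite leq_maxl.
  exists t; rewrite closeE.
  have [G [uG GE <-]] := halted_measureE t pfU.
  have leG : {in G, forall p, size p <= t} by move=> p; rewrite GE => /andP[/ltnW].
  have leFt : {in F, forall p, size p <= t} by move=> p /Ht /andP[/ltnW].
  have le_w : weight t F <= weight t G.
    apply: leq_trans (weight_le_cnt leFt uF _) (leq_trans (leq_cnt _) (cnt_le_weight leG)).
      by move=> p q /domF Up /domF; apply: pfU.
    move=> v _ /hasP[p Fp st]; apply/hasP; exists p => //.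
    by rewrite GE Ht.
  have le1 : ((digits n)%:R / 2 ^+ n <= Om)%R.
    by rewrite ler_pdivrMr // mulrC truncn_le mulr_ge0 // ltW.
  have le2 : ((weight t F)%:R / 2 ^+ t <= (weight t G)%:R / 2 ^+ t :> R)%R.
    by rewrite ler_pM2r ?invr_gt0 // ler_nat.
  apply: le_lt_trans le1 _; rewrite -ltrBlDr; apply: lt_le_trans le2.
  by rewrite -(weightE R leFt) (weightE R leF).
(* [Omega] is less than [2 * 2 ^- n] above the halted measure, while a missing [p] shorter than [n]
   would add at least that much. *)
have near n t p : close n t -> machine_dom U p -> size p < n -> halted U t p.
  rewrite closeE => cl domp ltn; apply/negPn/negP => nh.
  have [G [uG GE eG]] := halted_measureE t pfU; rewrite -/u in eG.
  have leG : {in G, forall p, size p <= t} by move=> q; rewrite GE => /andP[/ltnW].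
  have leF : {in p :: G, forall p', size p' <= maxn t (size p)}.
    move=> q; rewrite inE => /orP[/eqP ->|/leG le]; first exact: leq_maxr.
    by rewrite leq_max le.
  have domF : {in p :: G, forall p', machine_dom U p'}.
    by move=> q; rewrite inE => /orP[/eqP -> //|]; rewrite GE => /halted_dom.
  have uF : uniq (p :: G) by rewrite /= uG andbT GE.
  have := weight_le_halting R pfU uF domF leF.
  rewrite -weightE // big_cons (weightE R leG) eG -/Om => le1.
  have lt2 : (Om < (digits n)%:R / 2 ^+ n + 2 ^- n)%R.
    rewrite -[X in (_ + X)%R]mul1r -mulrDl ltr_pdivlMr // mulrC natr1.
    exact: truncnS_gt.
  have le3 : (2 * 2 ^- n <= 2 ^- size p :> R)%R.
    rewrite -(prednK (leq_ltn_trans (leq0n _) ltn)) exprS invfM mulrA divff ?mul1r ?pnatr_eq0 //.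
    rewrite lef_pV2 ?posrE // ler_eXn2l ?ltr1n //.
    by rewrite -ltnS prednK // (leq_ltn_trans _ ltn).
  have : (2 * 2 ^- n < 2 * 2 ^- n :> R)%R.
    apply: le_lt_trans le3 _; rewrite mulr2n mulrDl mul1r.
    move: cl lt2 le1; set a := (_ / 2 ^+ n)%R; set b := (_ / 2 ^+ t)%R; lra.
  by rewrite ltxx.
have recHM : recin (Omega R U) (fun t => halted_measure u t) by rewrite /halted_measure; solve_recin.
have Hdig : recin2 (Omega R U) (fun n t => nat_of_bool (close n t)) by rewrite /close; solve_recin.
(* The unary code of [e] has length [e + 1], so a program of [U] for the same output has length at
   most [e + 1 + d]. *)
pose ex e := ex_close (e + d + 2).
apply/turing_le_recin; apply: (@recin_ext _ (fun e => nat_of_bool (halt (ex_minn (ex e)) 0 e e))).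
  move=> e; case: ex_minnP => t cl _; congr nat_of_bool.
  apply/idP/asboolP => [h|]; first by apply/jump_halt; exists t; rewrite restr_set0.
  move=> /jump_halt[w]; rewrite restr_set0 => hw.
  have exP : exists y, P (str_num (unary_code e)) y.
    by exists (npair e w); rewrite /P nfst_npair nsnd_npair str_num_unary_code eqxx.
  case: (ex_minnP exP) => y Py min_y; have [s es] := str_num_surj y.
  have [q Uq le_q] : exists2 q, machine U q s & size q <= size (unary_code e) + d.
    apply: Hd; apply/HM; rewrite es; split=> // k lt.
    by apply/negP => /min_y; rewrite leqNgt lt.
  (* Having halted by stage [t], [q] has its output below [t], and with it the halting stage that
     the output codes. *)
  have /andP[_ /bexnP[z ltz hz]] : halted U t q.
    apply: near cl _ _; first by exists s.
    by move: le_q; rewrite size_unary_code; lia.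
  have ag : agree t 0 set0 by rewrite -(restr_set0 t); apply: agree_restr.
  have ez : z = y by rewrite -es; apply: prog_eval_det (eval_stage_sound ag hz) Uq.
  have /andP[/eqP ek hy] := Py.
  have ee : e = nfst y.
    move: ek; rewrite str_num_unary_code => ek.
    have : unary_code e = unary_code (nfst y) by apply: str_num_inj; rewrite !str_num_unary_code.
    by move=> eu; apply: prefix_unary_code; rewrite eu prefix_refl.
  rewrite {1 2}ee; apply: halt_mono hy => //.
  have := npair_ge_r (nfst y) (nsnd y); rewrite npair_eta; lia.
have Hex : recin (Omega R U) (fun e => ex_minn (ex e)).
  apply: (recin_search (R := fun e t => close (e + d + 2) t)); solve_recin.
solve_recin.
Qed.

(** * The low half, the coded half and their join *)

Theorem mainTheorem12 (R : realType) (U : prog) (hU : universal_prefix_free U)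
    (A : set nat) (hA : turing_le (Omega R U) A) :
  exists X Y : set nat,
    [/\ turing_degree A (tjoin X Y),
        ml_random R (tjoin X Y),
        low X
      & turing_incomplete Y].
Proof.
have KA : turing_le (jump set0) A := turing_le_trans (jump_le_Omega R hU) hA.
have [X lowX fatX] := exists_low_fat.
have JA : turing_le (jump X) A := turing_le_trans lowX KA.
have XK : turing_le X (jump set0) := turing_le_trans (le_jump X) lowX.
have XA : turing_le X A := turing_le_trans XK KA.
pose al s y := alive (2 * s) (njoin s (restr X s) y).
have Hal : recin2 X (fun s v => nat_of_bool (al s v)).
  by rewrite /al /alive /killed /section_stage /njoin; solve_recin.
have al_down s t v : t <= s -> al s v -> al t (v %% 2 ^ t).
  move=> le; rewrite /al -(restr_modn X le) -(njoin_modn _ v le); apply: alive_mono.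
  by rewrite leq_mul2l.
have [Y [HY YA decode]] := kucera_coding Hal al_down fatX JA.
have rand : ml_random R (tjoin X Y).
  (* [HY s] concerns the segment of length [2 * s], from which the shorter one inherits survival. *)
  apply: alive_ml_random => s; rewrite -(@restr_modn _ (2 * s)); last by lia.
  apply: (@alive_mono (2 * s)); first by lia.
  by rewrite -njoin_tjoin; apply: HY.
exists X, Y; split=> //.
- split.
    apply/turing_le_recin; apply: (@recin_ext _ (fun n =>
        if odd n then nat_of_bool `[<Y n./2>] else `[<X n./2>])).
      by move=> n; rewrite /tjoin /=; case: odd.
    have := XA => /turing_le_recin XA'; have := YA => /turing_le_recin YA'.
    have half_A := recin_half (recin_id A).
    by apply: recin_if; [solve_recin|exact: recin_comp YA' half_A|exact: recin_comp XA' half_A].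
  apply: decode; apply/turing_le_recin.
    apply: (@recin_ext _ (fun n => nat_of_bool `[<tjoin X Y (2 * n)>])); last by solve_recin.
    by move=> n; rewrite /tjoin /= oddM /= mul2n doubleK.
  apply: (@recin_ext _ (fun n => nat_of_bool `[<tjoin X Y (2 * n).+1>])); last by solve_recin.
  by move=> n; rewrite /tjoin /= oddM /= mul2n uphalf_double.
- by split=> //; apply: jump_set0_le.
- by move=> KY; apply: (computed_half_not_random (turing_le_trans XK KY) rand).
Qed.
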